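(* Let $l\geqslant 1$, the bump function $g$ and the single-site distribution $\mu$ be as in the context, and put $$\widetilde g:=g-\frac1l\int_0^l g(t)\,dt,\qquad c_2:=\frac{3\,\|\widetilde g\|_{L_2(0,l)}^2}{2\,l^3},\qquad c_3:=\frac{3\,\|\widetilde g\|_{L_2(0,l)}^2}{5000\,l^7}.$$ Let $\gamma>34$. Then there exists an initial scale $N_1$ such that for every $N\in\mathbb{N}$ with $N\geqslant N_1$ the interval $$I_N:=\left[\frac{2\,N^{\frac1\gamma-\frac14}}{\mathbb{E}\{\omega_k\}\sqrt{c_2}}\,,\; c_3\,N^{-\frac{15}{2\gamma}}\right]$$ is non-empty, and such that for every $N\geqslant N_1$ and every $\kappa\in I_N$ $$\mathbb{P}\left(\omega\in\Omega \mid \lambda_{\kappa,\omega}(N)-1\leqslant N^{-\frac12}\right)\leqslant N^{1-\frac1\gamma}\,e^{-c_4N^{1/\gamma}},$$ where $c_4>0$ is a constant depending only on $\mu$.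
   Context: Let $l\geqslant 1$ and let $g\in C_0^2(0,l)$ be real-valued (twice continuously differentiable with compact support in $(0,l)$, extended by $0$ to $\mathbb{R}$), normalized by $\max\{\|g\|_{C[0,l]},\|g'\|_{C[0,l]},\|g''\|_{C[0,l]}\}=1$. Let $(\omega_k)_{k\in\mathbb{Z}}$ be independent, identically distributed, non-negative, non-trivial (not almost surely equal to $0$) random variables with common distribution $\mu$, a probability measure on $[0,\infty)$ with support in $[0,1]$. The configuration space is $\Omega=\times_{k\in\mathbb{Z}}[0,\infty)$ with product measure $\mathbb{P}=\bigotimes_{k\in\mathbb{Z}}\mu$; its elements are $\omega=(\omega_k)_{k\in\mathbb{Z}}$. $\mathbb{E}\{\omega_k\}$ is the expectation of any one $\omega_k$. Put $G(x_1,\omega):=\sum_{k\in\mathbb{Z}}\omega_k\,g(x_1-kl)$. For $\kappa>0$ and $N\in\mathbb{N}$ define the waveguide segment $$D_{\kappa,\omega}(N):=\{x\in\mathbb{R}^2\mid 0<x_1<Nl,\ \kappa G(x_1,\omega)<x_2<\kappa G(x_1,\omega)+\pi\},$$ and let $\Gamma_{\kappa,\omega}(N)$ be the lower and upper part of its boundary, i.e. the points with $0<x_1<Nl$ and $x_2=\kappa G(x_1,\omega)$ or $x_2=\kappa G(x_1,\omega)+\pi$. Let $\mathcal{H}_{\kappa,\omega}(N)$ be the negative Laplace operator on $D_{\kappa,\omega}(N)$ with Dirichlet boundary conditions on $\Gamma_{\kappa,\omega}(N)$ and Neumann boundary conditions on the rest of the boundary (the vertical sides), and let $\lambda_{\kappa,\omega}(N)$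 be its lowest eigenvalue. *)

(* Defs.v *)
From HB Require Import structures.
From mathcomp Require Import all_boot all_order all_algebra.
From mathcomp Require Import all_classical all_reals all_analysis.
Set Implicit Arguments.
Unset Strict Implicit.
Unset Printing Implicit Defensive.
Import Order.TTheory GRing.Theory Num.Theory.
Import numFieldNormedType.Exports.
Local Open Scope classical_set_scope.
Local Open Scope ring_scope.

Section Operator.
Context {R : realType}.
Implicit Types (D Gamma : set (R * R)) (u f phi : R * R -> R).

Definition lebesgue2 := (@lebesgue_measure R \x @lebesgue_measure R)%E.

Definition L2 D u := u \_ D \in Lfun lebesgue2 2%:E.

Definition L2_cvg D (phi : nat -> R * R -> R) u :=
  'N[lebesgue2]_2%:E[EFin \o ((phi n \- u) \_ D)%R]%E @[n --> \oo] --> 0%E.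

Definition d1 phi : R * R -> R := fun x => 'D_(1, 0) phi x.
Definition d2 phi : R * R -> R := fun x => 'D_(0, 1) phi x.

Definition C1 phi :=
  [/\ forall x, derivable phi x (1, 0), forall x, derivable phi x (0, 1),
      continuous (d1 phi) & continuous (d2 phi)].

(* The form domain {u in H^1(D) | u = 0 on Gamma}, as the closure in the norm
   of H^1(D) of the C^1 functions that vanish on Gamma; (v1, v2) is the weak
   gradient of u, which is carried along because u determines it only up to
   null sets. *)
Definition form_domain D Gamma u (v1 v2 : R * R -> R) :=
  [/\ L2 D u, L2 D v1, L2 D v2 &
    exists phi : nat -> R * R -> R,
      [/\ forall n, C1 (phi n) /\ (forall x, Gamma x -> phi n x = 0),
          L2_cvg D phi u,
          L2_cvg D (fun n => d1 (phi n)) v1 &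
          L2_cvg D (fun n => d2 (phi n)) v2]].

(* Graph of the self-adjoint operator of L^2(D) associated with the closed form
   u |-> \int_D |grad u|^2: the negative Laplacian with Dirichlet condition on
   Gamma and, as natural boundary condition, Neumann condition on the rest of
   the boundary. *)
Definition neg_laplacian D Gamma u f :=
  L2 D f /\
  exists v1 v2 : R * R -> R, form_domain D Gamma u v1 v2 /\
    forall w z1 z2, form_domain D Gamma w z1 z2 ->
      \int[lebesgue2]_(x in D) (v1 x * z1 x + v2 x * z2 x) =
      \int[lebesgue2]_(x in D) (f x * w x).

Definition is_eigenvalue D Gamma (lam : R) :=
  exists u, ~ {ae lebesgue2, forall x, D x -> u x = 0} /\
    neg_laplacian D Gamma u (fun x => lam * u x).

(* On the bounded domains below the resolvent is compact, so this infimum is a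
   minimum; it is taken in the extended reals only to make it total. *)
Definition lowest_eigenvalue D Gamma : \bar R :=
  ereal_inf [set lam%:E | lam in is_eigenvalue D Gamma].

End Operator.

Section Configurations.
Context {R : realType}.

HB.instance Definition _ := Choice.on {nonneg R}.
HB.instance Definition _ := isPointed.Build {nonneg R} 0%:nng.

Definition cylinders : set (set (int -> {nonneg R})) :=
  [set A | exists k : int, exists2 B : set R, measurable B &
             A = (fun w => (w k)%:num) @^-1` B].

Definition Omega : Type := g_sigma_algebraType cylinders.
HB.instance Definition _ := Measurable.on Omega.

(* By uniqueness of extension from finite-dimensional rectangles, for mu carried
   by [0, +oo[ the only such P is the product of copies of mu. *)
Definition iid_law (mu : probability (measurableTypeR R) R)
    (P : probability Omega R) :=
  forall (s : seq int) (B : int -> set R), uniq s ->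
    (forall k, measurable (B k)) ->
    P [set w : int -> {nonneg R} | forall k, k \in s -> B k (w k)%:num] =
    (\prod_(k <- s) mu (B k))%E.

End Configurations.
Arguments Omega R : clear implicits.

Section Waveguide.
Context {R : realType}.
Variables (l : R) (g : R -> R).

Definition sup_norm (f : R -> R) : R := sup [set `|f x| | x in `[0, l]].

Definition is_bump : Prop :=
  [/\ [/\ forall x, derivable g x 1, forall x, derivable (derive1 g) x 1 &
          continuous (derive1n 2 g)],
      compact (closure [set x | g x != 0]),
      closure [set x | g x != 0] `<=` `]0, l[ &
      Num.max (sup_norm g)
        (Num.max (sup_norm (derive1 g)) (sup_norm (derive1n 2 g))) = 1].

(* For a bump function at most one term of this sum is nonzero. *)
Definition G (w : Omega R) (x1 : R) : R :=
  \sum_(k \in [set: int]) (w k)%:num * g (x1 - k%:~R * l).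

Definition segment (kappa : R) (w : Omega R) (N : nat) : set (R * R) :=
  [set x | 0 < x.1 < N%:R * l /\
           kappa * G w x.1 < x.2 < kappa * G w x.1 + pi].

Definition dirichlet_boundary (kappa : R) (w : Omega R) (N : nat) :
    set (R * R) :=
  [set x | 0 < x.1 < N%:R * l /\
           (x.2 = kappa * G w x.1 \/ x.2 = kappa * G w x.1 + pi)].

Definition lambda (kappa : R) (w : Omega R) (N : nat) : \bar R :=
  lowest_eigenvalue (segment kappa w N) (dirichlet_boundary kappa w N).

Definition gtilde (x : R) : R :=
  g x - l^-1 * \int[lebesgue_measure]_(t in `[0, l]) g t.

Definition gtilde_norm2 : R :=
  \int[lebesgue_measure]_(t in `]0, l[) (gtilde t) ^+ 2.

Definition c2 : R := 3 * gtilde_norm2 / (2 * l ^+ 3).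
Definition c3 : R := 3 * gtilde_norm2 / (5000 * l ^+ 7).

Definition mean (mu : probability (measurableTypeR R) R) : R := \int[mu]_x x.

Definition kappa_interval (mu : probability (measurableTypeR R) R) (gamma : R)
    (N : nat) : set R :=
  `[2 * N%:R `^ (gamma^-1 - 4^-1) / (mean mu * Num.sqrt c2),
    c3 * N%:R `^ (- (15 / (2 * gamma)))].

End Waveguide.

(* Main.v *)
(* For any vector field (p, q) and any C^1 function phi vanishing on the curved
   walls, |grad phi|^2 >= 2 phi (p d1 phi + q d2 phi) - (p^2 + q^2) phi^2, and
   integration by parts turns the right-hand side into
   (- div (p, q) - p^2 - q^2) phi^2 plus boundary terms on the vertical sides.
   In the straightened coordinate y = x2 - kappa G(x1) take
     p = - kappa t G' cos y + kappa^2 alpha,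
     q = cot y + kappa t G'' sin y / 3 - kappa^2 (t / 4) G'^2 sin y cos y.
   Then - div (p, q) - p^2 - q^2 >= 1 + kappa^2 (v - alpha') - O(kappa^3) with the
   effective potential v = (3/8) t G'^2 - t^2 (G'^2 + G''^2), whose mean over a cell
   is w_k^2 m / l with m > 0 for t small.  The free function alpha spreads this gain
   out: if every window of n cells contains a site with w_k >= e, a bounded alpha
   yields lambda - 1 >= kappa^2 A / (2 n l) - O(kappa^3) with A = e^2 m.  For n of
   order N^(1/gamma) and kappa in I_N this exceeds N^(-1/2), and by independence some
   window contains no such site with probability at most (N / n) P(w_k < e)^n. *)

Require Import Defs.
From mathcomp Require Import all_boot all_order all_algebra.
From mathcomp Require Import all_classical all_reals all_analysis.
From mathcomp Require Import measurable_realfun.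
From mathcomp Require Import zify ring lra.
Set Implicit Arguments.
Unset Strict Implicit.
Unset Printing Implicit Defensive.
Import Order.TTheory GRing.Theory Num.Theory.
Import numFieldNormedType.Exports.
Local Open Scope classical_set_scope.
Local Open Scope ring_scope.

(** * Calculus in the plane and on intervals *)

(** The field expands in kappa around cot y, the logarithmic derivative of the ground state sin y of
    the straight strip, for which - q' - q^2 = 1. At order kappa the term - t G' cos y of p produces
    t G'' cos y. The term t G'' sin y / 3 of q is the solution that cancels it: its contribution -
    q' - 2 q cot y is - t G'' cos y. At order kappa^2 the tilt of the coordinates yields t G'^2 sin
    y, which degenerates at the walls. The last term of q adds t G'^2 (3/4 - sin^2 y), so that the
    sum is at least (3/4) t G'^2 for every y. The squares cost only order t^2, which is why a small
    t wins. The obstacle that shapes alpha is the Neumann condition: test functions are free on the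
    vertical sides, so the boundary terms must have the right sign. This asks for alpha <= 0 on the
    left side and alpha >= 0 on the right side, and lets alpha jump downwards between cells. *)

Section Plane.
Context {R : realType}.
Implicit Types (f phi : R * R -> R) (x y : R).

(** The plane carries the product sigma-algebra, so [U] is written as the countable union of the
    rational open rectangles that it contains. *)
Lemma open_measurable2 (U : set (R * R)) : open U -> measurable U.
Proof.
move=> oU.
pose rect (q : rat * rat * (rat * rat)) : set (R * R) :=
  (`](ratr q.1.1), (ratr q.1.2)[ `*` `](ratr q.2.1), (ratr q.2.2)[)%classic.
pose F q := if `[< rect q `<=` U >] then rect q else set0.
suff -> : U = \bigcup_q F q.
  apply: countable_bigcupT_measurable => [|q]; first exact: countableP.
  rewrite /F; case: ifP => _; last exact: measurable0.
  by apply: measurableX; exact: measurable_itv.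
apply/seteqP; split => [[a b] Uab|p [q _]]; last first.
  by rewrite /F; case: asboolP => // + /= => /[apply].
have : nbhs (a, b) U by apply: open_nbhs_nbhs.
move=> [[A B]/= [/nbhs_ballP[e /= e0 eA] /nbhs_ballP[d /= d0 dB]] ABU].
have [q1] := @rat_in_itvoo R (a - e) a ltac:(lra).
have [q2] := @rat_in_itvoo R a (a + e) ltac:(lra).
have [q3] := @rat_in_itvoo R (b - d) b ltac:(lra).
have [q4] := @rat_in_itvoo R b (b + d) ltac:(lra).
rewrite !in_itv /= => /andP[q41 q42] /andP[q31 q32] /andP[q21 q22] /andP[q11 q12].
exists ((q1, q2), (q3, q4)) => //; rewrite /F; case: asboolP => [_|[]].
  by split; rewrite /= in_itv /=; apply/andP; split.
move=> [a' b'] [/=]; rewrite !in_itv /= => /andP[? ?] /andP[? ?].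
apply: ABU; split => /=; [apply: eA|apply: dB];
  rewrite /ball /= ltr_distl; apply/andP; split; lra.
Qed.

Lemma continuous_measurable_fun2 f : continuous f -> measurable_fun setT f.
Proof.
move=> /continuousP cf; apply: (measurability _ (RGenOpens.measurableE R)).
move=> _ [_ [a [b ->]] <-]; rewrite setTI; apply: open_measurable2.
by apply: cf; exact: interval_open.
Qed.

Lemma derivable1_slice1 phi x y : derivable phi (x, y) (1, 0) ->
  is_derive x 1 (fun t => phi (t, y)) (d1 phi (x, y)).
Proof.
move=> dphi.
have E : (fun h : R => h^-1 *: (phi (h *: (1, 0) + (x, y)) - phi (x, y))) =
  (fun h : R => h^-1 *: (phi (h *: 1 + x, y) - phi (x, y))).
  apply/funext => h; congr (_ *: (phi _ - _)).
  by congr pair; rewrite /= ?scaler0 ?add0r.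
split; first by rewrite /derivable /= -E.
by rewrite /derive /= /d1 /derive /= -E.
Qed.

Lemma derivable1_slice2 phi x y : derivable phi (x, y) (0, 1) ->
  is_derive y 1 (fun t => phi (x, t)) (d2 phi (x, y)).
Proof.
move=> dphi.
have E : (fun h : R => h^-1 *: (phi (h *: (0, 1) + (x, y)) - phi (x, y))) =
  (fun h : R => h^-1 *: (phi (x, h *: 1 + y) - phi (x, y))).
  apply/funext => h; congr (_ *: (phi _ - _)).
  by congr pair; rewrite /= ?scaler0 ?add0r.
split; first by rewrite /derivable /= -E.
by rewrite /derive /= /d2 /derive /= -E.
Qed.

Lemma MVTr (f df : R -> R) (a b : R) :
  (forall x, is_derive x 1 f (df x)) ->
  exists2 c, `|c - a| <= `|b - a| & f b - f a = df c * (b - a).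
Proof.
move=> dfE.
have cf A : {within A, continuous f}.
  apply: continuous_subspaceT => x.
  apply: differentiable_continuous; apply/derivable1_diffP.
  by have [] := dfE x.
have [ab|ba] := leP a b.
  have [c] := MVT_segment ab (fun x _ => dfE x) (cf _).
  rewrite in_itv /= => /andP[ac cb] E; exists c => //.
  by rewrite !ger0_norm; lra.
have [c] := MVT_segment (ltW ba) (fun x _ => dfE x) (cf _).
rewrite in_itv /= => /andP[bc ca] E; exists c => //; last by lra.
by rewrite !ler0_norm; lra.
Qed.

Lemma cvg_at2 (f : R * R -> R) (x0 y0 : R) : {for (x0, y0), continuous f} ->
  forall e, 0 < e -> exists2 d, 0 < d & forall x y,
    `|x - x0| <= d -> `|y - y0| <= d -> `|f (x, y) - f (x0, y0)| < e.
Proof.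
move=> cf e e0.
have : nbhs (f (x0, y0)) (ball (f (x0, y0)) e) by exact: nbhsx_ballx.
move=> /cf [[A B]/= [/nbhs_ballP[a /= a0 aA] /nbhs_ballP[b /= b0 bB]] ABU].
exists (Num.min a b / 2) => [|x y xd yd]; first by rewrite divr_gt0// lt_min a0.
have m0 : 0 < Num.min a b by rewrite lt_min a0.
have hl r : `|r| <= Num.min a b / 2 -> `|r| < Num.min a b by move=> ?; lra.
have /hl : `|x0 - x| <= Num.min a b / 2 by rewrite distrC.
have /hl : `|y0 - y| <= Num.min a b / 2 by rewrite distrC.
rewrite !lt_min => /andP[_ yb] /andP[xa _].
rewrite distrC; apply: (ABU (x, y)); split => /=; [exact: aA|exact: bB].
Qed.

(** [C1] asks for continuous partial derivatives and leaves continuity to be derived. A horizontal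
    increment is bounded by the mean value theorem, [d1 phi] being bounded near the point; the
    vertical increment is taken on the one line through the point, where the slice is continuous. *)
Lemma C1_continuous phi : C1 phi -> continuous phi.
Proof.
move=> [dx dy cx cy] [x0 y0].
apply/cvgrPdist_lt => e e0.
have cy0 : {for y0, continuous (fun t => phi (x0, t))}.
  apply: differentiable_continuous; apply/derivable1_diffP.
  by have [] := derivable1_slice2 (dy (x0, y0)).
have [d d0 dP] := cvg_at2 (cx (x0, y0)) ltr01.
pose M := `|d1 phi (x0, y0)| + 1.
have M0 : 0 < M by rewrite ltr_wpDl.
have M2 : 0 < e / 2 / M by rewrite !divr_gt0.
have e20 : 0 < e / 2 by lra.
move/cvgrPdist_lt : cy0 => /(_ _ e20) /nbhs_ballP[d' /= d'0 d'P].
pose r := Num.min (Num.min d d') (e / 2 / M).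
have r0 : 0 < r by rewrite !lt_min d0 d'0 M2.
exists (ball x0 r, ball y0 r) => /=; first by split; exact: nbhsx_ballx.
move=> [x y] /= [bx by_].
have := bx; rewrite /ball /= !lt_min => /andP[/andP[xd xd'] xM].
have := by_; rewrite /ball /= !lt_min => /andP[/andP[yd yd'] yM].
have [c cx0 E] := MVTr x0 x (fun t => derivable1_slice1 (dx (t, y))).
have h1 : `|phi (x, y) - phi (x0, y)| < e / 2.
  rewrite E normrM.
  have h2 : `|d1 phi (c, y)| < M.
    have := dP c y; rewrite /M => h.
    have {}h : `|d1 phi (c, y) - d1 phi (x0, y0)| < 1.
      apply: h; last by rewrite distrC ltW.
      by apply: (le_trans cx0); rewrite distrC ltW.
    have := ler_normD (d1 phi (c, y) - d1 phi (x0, y0)) (d1 phi (x0, y0)).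
    by rewrite subrK => ?; lra.
  rewrite distrC in xM.
  have : `|d1 phi (c, y)| * `|x - x0| <= M * `|x - x0|.
    by rewrite ler_wpM2r// ltW.
  move=> /le_lt_trans; apply.
  by rewrite mulrC -ltr_pdivlMr.
have h2 := d'P y yd'.
rewrite /= in h2.
have -> : phi (x0, y0) - phi (x, y) =
  (phi (x0, y0) - phi (x0, y)) - (phi (x, y) - phi (x0, y)) by ring.
apply: le_lt_trans (ler_normB _ _) _.
rewrite [e]splitr; exact: ltrD.
Qed.

(** The increment is split at (x, c (x + h)). The vertical part is a chain rule in one variable at
    fixed x; the horizontal quotient is [d1 phi] at an intermediate point, which tends to (x, c
    x). *)
Lemma C1_curve_derive phi (c : R -> R) x dc : C1 phi -> is_derive x 1 c dc ->
  is_derive x 1 (fun t => phi (t, c t)) (d1 phi (x, c x) + d2 phi (x, c x) * dc).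
Proof.
move=> [dx dy cx cy] dcx.
have cc : {for x, continuous c}.
  by apply: differentiable_continuous; apply/derivable1_diffP; case: dcx.
have D2 : is_derive x 1 (fun t => phi (x, c t)) (d2 phi (x, c x) * dc).
  have := is_derive1_comp (derivable1_slice2 (dy (x, c x))) dcx.
  by [].
suff H : h^-1 *: (phi (h *: 1 + x, c (h *: 1 + x)) - phi (x, c x))
    @[h --> 0^'] --> d1 phi (x, c x) + d2 phi (x, c x) * dc.
  split; first by apply/cvg_ex; eexists; exact: H.
  exact/cvg_lim.
have [/cvg_ex[l Hl] El] := D2.
have {}El : l = d2 phi (x, c x) * dc by rewrite -El; apply/esym/cvg_lim.
rewrite El in Hl.
suff H : h^-1 *: (phi (h *: 1 + x, c (h *: 1 + x)) - phi (x, c (h *: 1 + x)))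
    @[h --> 0^'] --> d1 phi (x, c x).
  have HD := cvgD H Hl.
  rewrite (_ : (fun h : R => _) = (fun h : R =>
    h^-1 *: (phi (h *: 1 + x, c (h *: 1 + x)) - phi (x, c (h *: 1 + x))) +
    h^-1 *: (phi (x, c (h *: 1 + x)) - phi (x, c x)))); first exact: HD.
  by apply/funext => h; rewrite -scalerDr addrA subrK.
apply/cvgrPdist_lt => e e0.
have [d d0 dP] := cvg_at2 (cx (x, c x)) e0.
move/cvgrPdist_lt : cc => /(_ _ d0) /nbhs_ballP[d' /= d'0 d'P].
exists (Num.min d d') => /=; first by rewrite lt_min d0.
move=> h /=; rewrite sub0r normrN lt_min => /andP[hd hd'] h0.
rewrite /GRing.scale /= mulr1.
have [z zx ->] := MVTr x (h + x) (fun t => derivable1_slice1 (dx (t, c (h + x)))).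
rewrite addrK in zx *.
rewrite mulrCA mulVf// mulr1 distrC; apply: dP.
  exact: le_trans zx (ltW _).
rewrite distrC ltW//; apply: d'P.
by rewrite /ball /= opprD addrCA subrr addr0 normrN.
Qed.

End Plane.

(** * Integrals over intervals and rectangles *)

Section Integrals.
Context {R : realType}.
Notation mu := (@lebesgue_measure R).

Lemma continuous_pair (T U V : topologicalType) (f : T -> U) (g : T -> V) (x : T) :
  {for x, continuous f} -> {for x, continuous g} ->
  {for x, continuous (fun t => (f t, g t))}.
Proof.
by move=> cf cg; exact: (@cvg_pair _ _ _ (nbhs x) (nbhs (f x)) (nbhs (g x))).
Qed.

Lemma is_derive1_continuous (F : R -> R) (x dF : R) :
  is_derive x 1 F dF -> {for x, continuous F}.
Proof.
by case=> dF' _; apply: differentiable_continuous; apply/derivable1_diffP.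
Qed.

Lemma continuous_integrable (f : R -> R) (a b : R) : continuous f ->
  mu.-integrable `[a, b] (EFin \o f).
Proof.
move=> cf; apply: continuous_compact_integrable; first exact: segment_compact.
exact: continuous_subspaceT.
Qed.

Lemma Rintegral_derive (F f : R -> R) (a b : R) : a < b ->
  (forall x, a <= x <= b -> is_derive x 1 F (f x)) ->
  {within `[a, b], continuous f} ->
  \int[mu]_(x in `[a, b]) f x = F b - F a.
Proof.
move=> ab dF cf; rewrite /Rintegral (continuous_FTC2 ab cf (F := F)) //.
  split.
  - move=> x; rewrite in_itv /= => /andP[ax xb].
    by have [] := dF x ltac:(lra).
  - by apply: cvg_at_right_filter; apply: is_derive1_continuous (dF a _); lra.
  - by apply: cvg_at_left_filter; apply: is_derive1_continuous (dF b _); lra.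
move=> x; rewrite in_itv /= => /andP[ax xb].
by rewrite derive1E; have [] := dF x ltac:(lra).
Qed.

(** On a short interval to the right of [c] the square stays above half of its value at [c], and
    this interval alone contributes a positive amount. *)
Lemma Rintegral_sqr_gt0 (f : R -> R) (a b c : R) : continuous f ->
  a < c < b -> f c != 0 -> 0 < \int[mu]_(x in `[a, b]) (f x) ^+ 2.
Proof.
move=> cf /andP[ac cb] fc0.
have f2c : continuous (fun x => f x ^+ 2).
  by move=> x; apply: (@continuous_comp _ _ _ f (fun y => y ^+ 2));
    [exact: cf|exact: exprn_continuous].
have r0 : 0 < f c ^+ 2 / 2 by rewrite divr_gt0// lt_def sqr_ge0 sqrf_eq0 fc0.
move/cvgrPdist_lt : (f2c c) => /(_ _ r0) /nbhs_ballP[d /= d0 dP].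
pose e := Num.min (d / 2) (b - c).
have e0 : 0 < e by rewrite lt_min; apply/andP; split; lra.
have ed : e < d by rewrite /e gt_min; apply/orP; left; lra.
have eb : e <= b - c by rewrite /e ge_min lexx orbT.
have fge x : c <= x <= c + e -> f c ^+ 2 / 2 <= f x ^+ 2.
  move=> /andP[cx xe].
  have : `|f c ^+ 2 - f x ^+ 2| < f c ^+ 2 / 2.
    by apply: dP; rewrite /ball /= ler0_norm; lra.
  by rewrite ltr_norml => /andP[_ ?]; lra.
apply: (@lt_le_trans _ _ (\int[mu]_(x in `[c, c + e]) (f c ^+ 2 / 2))).
  rewrite Rintegral_cst//= lebesgue_measure_itv /= lte_fin ltrDl e0 /=.
  by rewrite mulr_gt0//; lra.
rewrite -lee_fin /Rintegral !fineK; last 2 first.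
- exact/integrable_fin_num/continuous_integrable.
- apply/integrable_fin_num => //.
  by apply: (@continuous_integrable (fun=> _)) => x; exact: cvg_cst.
apply: (@le_trans _ _ (\int[mu]_(x in `[c, (c + e)%R]) (f x ^+ 2)%:E)%E).
  apply: ge0_le_integral => //=.
  - by move=> x _; rewrite lee_fin; lra.
  - apply/measurable_EFinP; apply: measurable_funTS.
    exact: continuous_measurable_fun.
apply: ge0_subset_integral => //=.
- apply/measurable_EFinP; apply: measurable_funTS.
  exact: continuous_measurable_fun.
- by move=> x _; rewrite lee_fin sqr_ge0.
- by move=> x /=; rewrite !in_itv /= => /andP[? ?]; apply/andP; split; lra.
Qed.

Lemma integral_shift (f : R -> R) (a b c : R) : a <= b -> continuous f ->
  (\int[mu]_(y in `[(a + c)%R, (b + c)%R]) (f y)%:E =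
   \int[mu]_(y in `[a, b]) (f (y + c)%R)%:E)%E.
Proof.
move=> ab cf; pose F (t : R) := t + c.
have dF (t : R) : is_derive t 1 F 1.
  by rewrite -[X in is_derive _ _ _ X]addr0; apply: is_deriveD.
have F'1 : F^`()%classic = cst 1.
  by apply/funext => t; rewrite derive1E; have [] := dF t.
rewrite -/(F a) -/(F b) (integration_by_substitution_increasing (F := F)) //.
- by apply: eq_integral => x _; rewrite F'1 /= mulr1.
- by move=> x y _ _ xy; rewrite /F ltrD2r.
- by rewrite F'1 => x _; exact: cvg_cst.
- by rewrite F'1; exact: is_cvg_cst.
- by rewrite F'1; exact: is_cvg_cst.
- split.
  + by move=> x _; have [] := dF x.
  + by apply: cvg_at_right_filter; apply: is_derive1_continuous (dF a).
  + by apply: cvg_at_left_filter; apply: is_derive1_continuous (dF b).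
- exact: continuous_subspaceT.
Qed.

Lemma continuous2_integrable (f : R * R -> R) (a b c d : R) : continuous f ->
  (mu \x mu)%E.-integrable setT ((EFin \o f) \_ (`[a, b] `*` `[c, d])).
Proof.
move=> cf; have mD : measurable (`[a, b] `*` `[c, d] : set (R * R)).
  by apply: measurableX; exact: measurable_itv.
have := @integrable_restrict _ _ R (mu \x mu)%E _ mD _ measurableT (EFin \o f).
rewrite setTI => H; apply/H => {H}.
apply: measurable_bounded_integrable => //.
- have E := @product_measure1E _ _ _ _ R mu mu _ _
    (measurable_itv `[a, b]) (measurable_itv `[c, d]).
  apply: (@eq_ind _ _ (fun z => (z < +oo)%E) _ _ (esym E)) => /=.
  by rewrite !lebesgue_measure_itv; do 2 case: ifP => _;
    rewrite ?mule0 ?mul0e// -!EFinB -EFinM ltry.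
- apply: measurable_funTS; exact: continuous_measurable_fun2.
- have : compact (f @` (`[a, b] `*` `[c, d])).
    apply: continuous_compact; first exact: continuous_subspaceT.
    by apply: compact_setX; exact: segment_compact.
  move=> /compact_bounded [M [Mr MP]]; exists M; split => // x Mx y Dy.
  by apply: (MP x Mx); exists y.
Qed.

(** Holds at every point and not only almost everywhere, so the extended-real inner integral of
    Fubini's theorem can be rewritten into the real iterated one. *)
Lemma fubini_F_rect (f : R * R -> R) (a b c d : R) : continuous f ->
  fubini_F mu ((EFin \o f) \_ (`[a, b] `*` `[c, d])) =
  (EFin \o fun x => \int[mu]_(y in `[c, d]) f (x, y)) \_ `[a, b].
Proof.
move=> cf; apply/funext => x; rewrite /fubini_F !patchE; case: ifPn => xab.
  rewrite /= /Rintegral fineK; last first.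
    apply: integrable_fin_num => //; apply: continuous_integrable => y.
    apply: (@continuous_comp _ _ _ (fun y => (x, y)) f); last exact: cf.
    by apply: continuous_pair => //; exact: cst_continuous.
  rewrite [RHS]integral_mkcond; apply: eq_integral => y _.
  by rewrite !patchE in_setX /= xab.
by apply: integral0_eq => y _; rewrite patchE in_setX /= (negbTE xab).
Qed.

(** Read off from Fubini's theorem instead of from continuity of the inner integral in its
    parameter. *)
Lemma continuous2_integrable1 (f : R * R -> R) (a b c d : R) : continuous f ->
  mu.-integrable `[a, b] (EFin \o fun x => \int[mu]_(y in `[c, d]) f (x, y)).
Proof.
move=> cf; have I := integrable_fubini_F (continuous2_integrable a b c d cf).
have {}I : mu.-integrable setT
    (fubini_F mu ((EFin \o f) \_ (`[a, b] `*` `[c, d]))) := I.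
rewrite (fubini_F_rect a b c d cf) in I.
have := @integrable_restrict _ _ R mu `[a, b] (measurable_itv _) _ measurableT
   (EFin \o fun x => \int[mu]_(y in `[c, d]) f (x, y)).
by rewrite setTI => H; apply/H.
Qed.

Lemma continuous_swap (f : R * R -> R) : continuous f ->
  continuous (fun z : R * R => f (z.2, z.1)).
Proof.
move=> cf z; apply: (@continuous_comp _ _ _ (fun z : R * R => (z.2, z.1)) f).
  by apply: continuous_pair; [exact: cvg_snd|exact: cvg_fst].
exact: cf.
Qed.

Lemma Fubini_rect (f : R * R -> R) (a b c d : R) : continuous f ->
  \int[mu]_(x in `[a, b]) \int[mu]_(y in `[c, d]) f (x, y) =
  \int[mu]_(y in `[c, d]) \int[mu]_(x in `[a, b]) f (x, y).
Proof.
move=> cf; rewrite /Rintegral; congr fine.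
have H1 := fubini_F_rect a b c d cf.
have H2 := fubini_F_rect c d a b (continuous_swap cf).
have := Fubini (continuous2_integrable a b c d cf).
rewrite -/(fubini_F mu _) -/(fubini_G mu _).
rewrite [in X in _ -> X = _]integral_mkcond [in X in _ -> _ = X]integral_mkcond.
rewrite -[X in _ -> (\int[mu]_x X x = _)%E]H1 -[X in _ -> (_ = \int[mu]_x X x)%E]H2.
move=> ->; apply: eq_integral => y _; apply: eq_integral => x _.
by rewrite !patchE !in_setX /= andbC.
Qed.

End Integrals.

(** * The certificate *)

Section Certificate.
Context {R : realType}.

(* [s c / sn] and [(1 + (c / sn)^2)] stand for [s cot tau] and [1 / sin^2 tau]. *)
Lemma certificate_bound (s c sn u i kap t G1 G2 al al1 K p px py q qy : R) :
  2^-1 <= s <= 1 -> s * i = 1 -> c = u * sn -> sn ^+ 2 + c ^+ 2 = 1 -> 0 <= sn ->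
  0 <= kap <= 1 -> 0 <= t <= 1 -> `|G1| <= 1 -> `|G2| <= 1 -> `|al| <= K ->
  p = - kap * t * G1 * c + kap ^+ 2 * al ->
  px = - kap * t * G2 * c + kap ^+ 2 * al1 ->
  py = kap * t * G1 * (s * sn) ->
  q = s * u + kap * t * G2 * (sn * i / 3) - kap ^+ 2 * (t / 4) * G1 ^+ 2 * (sn * c) ->
  qy = - s ^+ 2 * (1 + u ^+ 2) + kap * t * G2 * (c / 3)
    - kap ^+ 2 * (t / 4) * G1 ^+ 2 * (s * (c ^+ 2 - sn ^+ 2)) ->
  s ^+ 2 + kap ^+ 2 * (3 / 8 * t * G1 ^+ 2 - t ^+ 2 * (G1 ^+ 2 + G2 ^+ 2) - al1)
     - kap ^+ 3 * (1 + K) ^+ 2 <=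
  - px - qy + kap * G1 * py - p ^+ 2 - q ^+ 2.
Proof.
move=> /andP[s2 s1] si cu sc1 sn0 /andP[k0 k1] /andP[t0 t1] G11 G21 alK pE pxE pyE qE qyE.
have K0 : 0 <= K by exact: le_trans alK.
pose a := t * G1 * c; pose b := t * G2 * (sn * i / 3).
pose d := t / 4 * G1 ^+ 2 * (sn * c).
have c1 : `|c| <= 1.
  rewrite -[leRHS](@ger0_norm _ 1)// -ler_sqr ?nnegrE// -!normrX !ger0_norm ?sqr_ge0//.
  by have := sqr_ge0 sn; lra.
have sn1 : sn <= 1.
  by rewrite -ler_sqr ?nnegrE//; have := sqr_ge0 c; lra.
have i0 : 0 <= i by nra.
have i2 : i <= 2 by nra.
have a1 : `|a| <= 1.
  by rewrite !normrM (ger0_norm t0) !mulr_ile1 ?mulr_ge0.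
have a2 : a ^+ 2 <= t ^+ 2 * G1 ^+ 2.
  rewrite /a !exprMn ler_piMr//; last by have := sqr_ge0 sn; lra.
  by apply: mulr_ge0; exact: sqr_ge0.
have b1 : `|b| <= 2 / 3.
  rewrite /b normrM -[leRHS]mul1r ler_pM//.
    by rewrite normrM (ger0_norm t0) mulr_ile1.
  by rewrite ger0_norm ?divr_ge0 ?mulr_ge0//; nra.
have b2 : b ^+ 2 <= t ^+ 2 * G2 ^+ 2.
  rewrite /b exprMn [(t * G2) ^+ 2]exprMn ler_piMr//.
    by apply: mulr_ge0; exact: sqr_ge0.
  rewrite expr_le1//; first by nra.
  by rewrite divr_ge0 ?mulr_ge0.
have d1 : `|d| <= 1 / 4.
  rewrite /d [`|t / 4 * _ * _|]normrM -[leRHS]mulr1 ler_pM//.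
    rewrite normrM !ger0_norm ?sqr_ge0 ?divr_ge0//.
    have : G1 ^+ 2 <= 1 by rewrite -[G1 ^+ 2]ger0_norm ?sqr_ge0// normrX expr_le1.
    by move=> ?; nra.
  by rewrite normrM (ger0_norm sn0) mulr_ile1.
(* The terms of order [kap] cancel as 1 - 1/3 - 2/3 = 0, with contributions of [px], [qy] and
   [q ^+ 2]. In order [kap ^+ 2] the part free of [a], [b] and [al1] is t s G1^2 (c^2/4 - sn^2/4 +
   c^2/2 + sn), rewritten with c^2 = 1 - sn^2. *)
have key : - px - qy + kap * G1 * py - p ^+ 2 - q ^+ 2 =
  s ^+ 2 + kap ^+ 2 * (t * s * G1 ^+ 2 * (3 / 4 - sn ^+ 2 + sn) - al1)
  - kap ^+ 2 * (- a + kap * al) ^+ 2 - kap ^+ 2 * (b - kap * d) ^+ 2.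
  have usn : u * sn = c by [].
  have -> : q = s * u + kap * b - kap ^+ 2 * d.
    by rewrite qE /b /d; ring.
  have E1 : (s * u + kap * b - kap ^+ 2 * d) ^+ 2 =
    s ^+ 2 * u ^+ 2 + kap * t * G2 * (2 / 3) * (s * i) * (u * sn)
    - kap ^+ 2 * (t / 2) * G1 ^+ 2 * s * (u * sn) * c + kap ^+ 2 * (b - kap * d) ^+ 2.
    by rewrite /b /d; field.
  have s2E : sn ^+ 2 = 1 - c ^+ 2 by rewrite -sc1 addrK.
  by rewrite E1 si usn pE pxE qyE pyE /a !s2E; field.
rewrite key.
(* Since sn^2 <= sn on [0, 1] the bracket is at least 3/4, and s >= 1/2 leaves 3/8. *)
have h1 : 3 / 8 * t * G1 ^+ 2 <= t * s * G1 ^+ 2 * (3 / 4 - sn ^+ 2 + sn).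
  have tg : 0 <= t * G1 ^+ 2 by rewrite mulr_ge0 ?sqr_ge0.
  have : 3 / 8 <= s * (3 / 4 - sn ^+ 2 + sn) by nra.
  by move=> /(ler_wpM2l tg); lra.
have h2 : (- a + kap * al) ^+ 2 <= t ^+ 2 * G1 ^+ 2 + kap * (2 * K + K ^+ 2).
  have : `|a * al| <= K by rewrite normrM -[leRHS]mul1r ler_pM.
  rewrite ler_norml => /andP[aal _].
  have al2 : al ^+ 2 <= K ^+ 2 by rewrite -[leLHS]real_normK ?num_real// ler_sqr ?nnegrE.
  have : kap * (a * al) >= kap * - K by rewrite ler_wpM2l.
  have : kap ^+ 2 * al ^+ 2 <= kap * K ^+ 2.
    by rewrite ler_pM ?sqr_ge0// expr2 ler_piMr.
  by move=> ? ?; lra.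
(* This error [kap] and the error kap (2 K + K^2) of [h2] add up to kap (1 + K)^2. *)
have h3 : (b - kap * d) ^+ 2 <= t ^+ 2 * G2 ^+ 2 + kap.
  have : `|b * d| <= 2 / 3 * (1 / 4) by rewrite normrM ler_pM.
  rewrite ler_norml => /andP[bd _].
  have dd : d ^+ 2 <= (1 / 4) ^+ 2 by rewrite -[leLHS]real_normK ?num_real// ler_sqr ?nnegrE.
  have : kap * (b * d) >= kap * - (2 / 3 * (1 / 4)) by rewrite ler_wpM2l.
  have : kap ^+ 2 * d ^+ 2 <= kap * (1 / 4) ^+ 2.
    by rewrite ler_pM ?sqr_ge0// expr2 ler_piMr.
  by move=> ? ?; lra.
have kk : 0 <= kap ^+ 2 by exact: sqr_ge0.
have := ler_wpM2l kk h1; have := ler_wpM2l kk h2; have := ler_wpM2l kk h3.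
have -> : kap ^+ 3 = kap ^+ 2 * kap by rewrite exprSr.
by move: (kap ^+ 2) => k2 H1 H2 H3; lra.
Qed.

End Certificate.

(** * Rules for continuity and derivatives *)

Section Calculus.
Context {R : realType}.

Section Continuity.
Context {T : topologicalType}.
Implicit Types f g : T -> R.

Lemma contD f g : continuous f -> continuous g -> continuous (fun z => f z + g z).
Proof. by move=> cf cg z; apply: cvgD; [exact: cf|exact: cg]. Qed.

Lemma contN f : continuous f -> continuous (fun z => - f z).
Proof. by move=> cf z; apply: cvgN; exact: cf. Qed.

Lemma contM f g : continuous f -> continuous g -> continuous (fun z => f z * g z).
Proof. by move=> cf cg z; apply: cvgM; [exact: cf|exact: cg]. Qed.

Lemma cont_atD f g z : {for z, continuous f} -> {for z, continuous g} ->
  {for z, continuous (fun x => f x + g x)}.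
Proof. exact: cvgD. Qed.

Lemma cont_atM f g z : {for z, continuous f} -> {for z, continuous g} ->
  {for z, continuous (fun x => f x * g x)}.
Proof. exact: cvgM. Qed.

Lemma contX f n : continuous f -> continuous (fun z => f z ^+ n).
Proof.
move=> cf z; apply: (@continuous_comp _ _ _ f (fun y => y ^+ n)); first exact: cf.
exact: exprn_continuous.
Qed.

Lemma cont_comp (f : R -> R) g : continuous f -> continuous g ->
  continuous (fun z => f (g z)).
Proof.
by move=> cf cg z; apply: (@continuous_comp _ _ _ g f); [exact: cg|exact: cf].
Qed.

Lemma cont2 (f : R * R -> R) (g1 g2 : T -> R) : continuous f ->
  continuous g1 -> continuous g2 -> continuous (fun z => f (g1 z, g2 z)).
Proof.
move=> cf cg1 cg2 z.
apply: (@continuous_comp _ _ _ (fun z => (g1 z, g2 z)) f); last exact: cf.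
by apply: continuous_pair; [exact: cg1|exact: cg2].
Qed.

Lemma cont_cst (r : R) : continuous (fun _ : T => r).
Proof. by move=> z; exact: cvg_cst. Qed.

End Continuity.

Lemma cont_fst : continuous (fun z : R * R => z.1).
Proof. by move=> z; exact: cvg_fst. Qed.

Lemma cont_snd : continuous (fun z : R * R => z.2).
Proof. by move=> z; exact: cvg_snd. Qed.

Lemma cont_id : continuous (fun z : R => z).
Proof. by move=> z; exact: cvg_id. Qed.

(* [is_derive] is a class; this alias keeps [apply:] from resolving derivatives
   of opaque functions by instance search. *)
Definition has_deriv (f : R -> R) (x df : R) : Prop := is_derive x 1 f df.

Lemma has_deriv_eq f (x df df' : R) : has_deriv f x df' -> df' = df ->
  has_deriv f x df.
Proof. by move=> ? <-. Qed.

Lemma derD (f g : R -> R) (x df dg : R) : has_deriv f x df ->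
  has_deriv g x dg -> has_deriv (fun y => f y + g y) x (df + dg).
Proof. by move=> hf hg; exact: is_deriveD. Qed.

Lemma derN (f : R -> R) (x df : R) : has_deriv f x df ->
  has_deriv (fun y => - f y) x (- df).
Proof. by move=> hf; exact: is_deriveN. Qed.

Lemma derM (f g : R -> R) (x df dg : R) : has_deriv f x df ->
  has_deriv g x dg -> has_deriv (fun y => f y * g y) x (f x * dg + g x * df).
Proof. by move=> hf hg; exact: is_deriveM. Qed.

Lemma der_cst (r x : R) : has_deriv (fun=> r) x 0.
Proof. exact: is_derive_cst. Qed.

Lemma der_id (x : R) : has_deriv (fun y => y) x 1.
Proof. exact: is_derive_id. Qed.

Lemma der_comp (f g : R -> R) (x df dg : R) : has_deriv f (g x) df ->
  has_deriv g x dg -> has_deriv (fun y => f (g y)) x (df * dg).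
Proof. by move=> hf hg; exact: (is_derive1_comp hf hg). Qed.

Lemma derV (f : R -> R) (x df : R) : f x != 0 -> has_deriv f x df ->
  has_deriv (fun y => (f y)^-1) x (- (f x) ^- 2 * df).
Proof. by move=> fx0 hf; exact: is_deriveV. Qed.

Lemma has_deriv_cont (f : R -> R) (x df : R) :
  has_deriv f x df -> {for x, continuous f}.
Proof. exact: is_derive1_continuous. Qed.

End Calculus.

Ltac cont := repeat match goal with
  | H : continuous ?f |- continuous ?h => constr_eq f h; exact H
  | H : continuous ?f |- continuous (fun z => ?h z) => constr_eq f h; exact H
  | |- continuous (fun z => z) => exact (@cont_id _)
  | |- continuous (fun z => z.1) => exact (@cont_fst _)
  | |- continuous (fun z => z.2) => exact (@cont_snd _)
  | |- continuous fst => exact (@cont_fst _)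
  | |- continuous snd => exact (@cont_snd _)
  | |- continuous (fun z => ?c) => exact (@cont_cst _ _ c)
  | |- continuous (@GRing.add _ ?c) => exact (@contD _ _ _ _ (@cont_cst _ _ c) (@cont_id _))
  | |- continuous (@GRing.opp _) => exact (@contN _ _ _ (@cont_id _))
  | |- continuous (@GRing.mul _ ?c) => exact (@contM _ _ _ _ (@cont_cst _ _ c) (@cont_id _))
  | |- continuous (fun z => @GRing.add _ (@?f z) (@?g z)) => refine (@contD _ _ f g _ _)
  | |- continuous (fun z => @GRing.opp _ (@?f z)) => refine (@contN _ _ f _)
  | |- continuous (fun z => @GRing.exp _ (@?f z) ?n) => refine (@contX _ _ f n _)
  | |- continuous (fun z => @GRing.mul _ (@?f z) (@?g z)) => refine (@contM _ _ f g _ _)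
  | |- continuous (fun z => sin (@?g z)) => refine (@cont_comp _ _ sin g (@continuous_sin _) _)
  | |- continuous (fun z => cos (@?g z)) => refine (@cont_comp _ _ cos g (@continuous_cos _) _)
  | H : continuous ?f |- continuous (fun z => ?h (@?g1 z, @?g2 z)) =>
      constr_eq f h; refine (@cont2 _ _ f g1 g2 H _ _)
  | H : continuous ?f |- continuous (fun z => ?h (@?g z)) =>
      constr_eq f h; refine (@cont_comp _ _ f g H _)
  end.

(** * The certificate on one vertical slice *)

Section Slice.
Context {R : realType}.
Notation mu := (@lebesgue_measure R).
Context (F A B : R -> R) (h1 h2 al al1 kap t K s : R).
Context (cA : continuous A) (cB : continuous B).
Context (dF : forall y, has_deriv F y (B y)).
Context (kap01 : 0 <= kap <= 1) (t01 : 0 <= t <= 1) (s1 : 2^-1 <= s < 1).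
Context (h1_le1 : `|h1| <= 1) (h2_le1 : `|h2| <= 1) (al_leK : `|al| <= K).
Context (F0 : F 0 = 0) (Fpi : F pi = 0).

Let cF : continuous F. Proof. move=> y; exact: has_deriv_cont (dF y). Qed.

(* [s < 1] keeps [tau] inside ]0, pi[, so that [cot tau] is regular up to the
   Dirichlet boundary; [s] tends to [1] at the end. *)
Definition tau (y : R) := s * y + (1 - s) * (pi / 2).

Lemma sin_tau_gt0 y : 0 <= y <= pi -> 0 < sin (tau y).
Proof.
move=> /andP[y0 ypi]; apply: sin_gt0_pi.
have pi0 := @pi_gt0 R; move/andP: s1 => [s2 s3].
by rewrite /tau; apply/andP; split; nra.
Qed.

Let s0 : s != 0. Proof. by apply/eqP => s0; move/andP: s1 => [+ _]; rewrite s0; lra. Qed.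

Let ctau : continuous tau. Proof. by rewrite /tau; cont. Qed.

Let dtau y : has_deriv tau y s.
Proof.
rewrite /tau; apply: has_deriv_eq.
  apply: derD; last exact: der_cst.
  by apply: derM; [exact: der_cst|exact: der_id].
by rewrite mulr0 mulr1 !addr0.
Qed.

Let dsin y : has_deriv (fun y => sin (tau y)) y (cos (tau y) * s).
Proof. by apply: der_comp (dtau y); exact: is_derive_sin. Qed.

Let dcos y : has_deriv (fun y => cos (tau y)) y (- sin (tau y) * s).
Proof. by apply: der_comp (dtau y); exact: is_derive_cos. Qed.

(** With x1 fixed, [h1], [h2] are the values of G', G'' and [al], [al1] those of alpha, alpha'. Thus
    [pfieldx] is the derivative of the field in x1 at constant y. *)
Definition pfield y := - kap * t * h1 * cos (tau y) + kap ^+ 2 * al.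
Definition pfieldx y := - kap * t * h2 * cos (tau y) + kap ^+ 2 * al1.
Let py y := kap * t * h1 * (s * sin (tau y)).
(** The leading term s cot tau solves - q' - q^2 = s^2. The factor [s^-1] in the second term keeps
    the cancellation at order [kap] exact for [s] below 1. *)
Let q y := s * (cos (tau y) * (sin (tau y))^-1)
  + kap * t * h2 * (sin (tau y) * s^-1 / 3)
  - kap ^+ 2 * (t / 4) * h1 ^+ 2 * (sin (tau y) * cos (tau y)).
Let qy y := - s ^+ 2 * (1 + (cos (tau y) * (sin (tau y))^-1) ^+ 2)
  + kap * t * h2 * (cos (tau y) / 3)
  - kap ^+ 2 * (t / 4) * h1 ^+ 2 * (s * (cos (tau y) ^+ 2 - sin (tau y) ^+ 2)).

Let dq y : 0 <= y <= pi -> has_deriv q y (qy y).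
Proof.
move=> y0; have sn0 := lt0r_neq0 (sin_tau_gt0 y0).
rewrite /q; apply: has_deriv_eq.
  apply: derD; [apply: derD|apply: derN].
  - apply: derM; first exact: der_cst.
    by apply: derM (dcos y) _; apply: derV.
  - apply: derM; first exact: der_cst.
    by apply: derM (der_cst _ _); apply: derM (dsin y) (der_cst _ _).
  - by apply: derM (der_cst _ _) _; apply: derM (dsin y) (dcos y).
by rewrite /qy; field; rewrite s0 sn0.
Qed.

Let dp y : has_deriv pfield y (py y).
Proof.
rewrite /pfield; apply: has_deriv_eq.
  apply: derD (der_cst _ _).
  by apply: derM (der_cst _ _) (dcos y).
by rewrite /py; ring.
Qed.

(** In straightened coordinates d/dx1 becomes d/dx - kap G' d/dy, so q - kap G' p is the y-component
    of the field. Its flux [w] vanishes at both walls together with [F]. *)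
Let w y := (q y - kap * h1 * pfield y) * F y ^+ 2.
Let wy y := (qy y - kap * h1 * py y) * F y ^+ 2 +
  (q y - kap * h1 * pfield y) * (2 * F y * B y).

Let dw y : 0 <= y <= pi -> has_deriv w y (wy y).
Proof.
move=> y0; rewrite /w; apply: has_deriv_eq.
  apply: derM; last by apply: derM; exact: dF.
  apply: derD (dq y0) _; apply: derN.
  by apply: derM (der_cst _ _) (dp y).
by rewrite /wy; ring.
Qed.

Let cpy : continuous py. Proof. by rewrite /py; cont. Qed.
Let cp : continuous pfield. Proof. by rewrite /pfield; cont. Qed.
Let cpx : continuous pfieldx. Proof. by rewrite /pfieldx; cont. Qed.

Let cqy y : 0 <= y <= pi -> {for y, continuous qy}.
Proof.
move=> y0; have sn0 := lt0r_neq0 (sin_tau_gt0 y0).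
have cu : {for y, continuous (fun y => (sin (tau y))^-1)}.
  by apply: has_deriv_cont; apply: derV => //; exact: dsin.
have cc : {for y, continuous (fun y => cos (tau y))} := has_deriv_cont (dcos y).
apply: cont_atD.
  apply: cont_atD.
    apply: cont_atM; first exact: cont_cst.
    by apply: cont_atD; [exact: cont_cst|apply: cont_atM; apply: cont_atM].
  have cr : continuous (fun y => kap * t * h2 * (cos (tau y) / 3)) by cont.
  exact: cr.
have cr : continuous (fun y => - (kap ^+ 2 * (t / 4) * h1 ^+ 2 *
  (s * (cos (tau y) ^+ 2 - sin (tau y) ^+ 2)))) by cont.
exact: cr.
Qed.

Let cwy : {within `[0, pi], continuous wy}.
Proof.
apply: continuous_in_subspaceT => y; rewrite inE /= in_itv /= => y0.
have c1 : continuous (fun y => - (kap * h1 * py y)) by cont.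
have c2 : continuous (fun y => F y ^+ 2) by cont.
have c3 : continuous (fun y => - (kap * h1 * pfield y)) by cont.
have c4 : continuous (fun y => 2 * F y * B y) by cont.
suff : {for y, continuous wy} by [].
apply: cont_atD; apply: cont_atM.
- by apply: cont_atD; [exact: cqy|exact: c1].
- exact: c2.
- by apply: cont_atD; [exact: has_deriv_cont (dq y0)|exact: c3].
- exact: c4.
Qed.

(** After adding [wy], whose integral is 0, the claim holds pointwise: it is the sum of the squares
    of A - p F and B - q F, combined with the certificate. The first integrand is the x-derivative
    of p Phi^2, left to be integrated over the cell. *)
Lemma slice_inequality :
  \int[mu]_(y in `[0, pi]) (pfieldx y * F y ^+ 2 +
      pfield y * (2 * F y * (A y + B y * (kap * h1)))) +
    (s ^+ 2 + kap ^+ 2 * (3 / 8 * t * h1 ^+ 2 - t ^+ 2 * (h1 ^+ 2 + h2 ^+ 2) - al1)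
       - kap ^+ 3 * (1 + K) ^+ 2) * \int[mu]_(y in `[0, pi]) F y ^+ 2 <=
  \int[mu]_(y in `[0, pi]) (A y ^+ 2 + B y ^+ 2).
Proof.
pose X0 := s ^+ 2 + kap ^+ 2 * (3 / 8 * t * h1 ^+ 2 -
  t ^+ 2 * (h1 ^+ 2 + h2 ^+ 2) - al1) - kap ^+ 3 * (1 + K) ^+ 2.
pose W y := pfieldx y * F y ^+ 2 +
      pfield y * (2 * F y * (A y + B y * (kap * h1))).
rewrite -/X0.
have wy0 : \int[mu]_(y in `[0, pi]) wy y = 0.
  rewrite (Rintegral_derive (@pi_gt0 R) dw cwy) /w.
  by rewrite Fpi F0 expr0n /= !mulr0 subrr.
have iwy : mu.-integrable `[0, pi] (EFin \o wy).
  by apply: continuous_compact_integrable; [exact: segment_compact|exact: cwy].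
have cW : continuous W by rewrite /W; cont.
have iW : mu.-integrable `[0, pi] (EFin \o W) by exact: continuous_integrable.
have iF : mu.-integrable `[0, pi] (EFin \o fun y => F y ^+ 2).
  by apply: continuous_integrable; cont.
have iF' : mu.-integrable `[0, pi] (EFin \o fun y => X0 * F y ^+ 2).
  by apply: continuous_integrable; cont.
have iAB : mu.-integrable `[0, pi] (EFin \o fun y => A y ^+ 2 + B y ^+ 2).
  by apply: continuous_integrable; cont.
have iWF : mu.-integrable `[0, pi] (EFin \o fun y => W y + X0 * F y ^+ 2).
  by apply: continuous_integrable; cont.
apply: (@le_trans _ _ (\int[mu]_(y in `[0, pi]) (W y + X0 * F y ^+ 2) +
    \int[mu]_(y in `[0, pi]) wy y)).
  by rewrite wy0 addr0 -RintegralZl// -RintegralD.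
rewrite -RintegralD//.
apply: le_Rintegral => //; first exact: (integrableD _ iWF iwy).
move=> y /=; rewrite in_itv /= => y0.
have sn0 := sin_tau_gt0 y0.
have X : X0 <= - pfieldx y - qy y + kap * h1 * py y - pfield y ^+ 2 - q y ^+ 2.
  apply: (@certificate_bound R s (cos (tau y)) (sin (tau y))
     (cos (tau y) * (sin (tau y))^-1) s^-1 kap t h1 h2 al al1 K) => //.
  - by move/andP: s1 => [-> /ltW].
  - by rewrite divff.
  - by rewrite mulfVK// gt_eqF.
  - by rewrite addrC cos2Dsin2.
  - exact: ltW.
have := ler_wpM2r (sqr_ge0 (F y)) X.
have := sqr_ge0 (A y - pfield y * F y).
have := sqr_ge0 (B y - q y * F y).
rewrite /W /wy; move: (X0) (F y) (A y) (B y) (pfield y) (pfieldx y) (q y) (qy y) (py y).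
by move=> X1 F1 a0 b0 p0 px0 q0 qy0 py0 *; lra.
Qed.

End Slice.

(** * Integration of the slices over one cell *)

Section Cell.
Context {R : realType}.
Notation mu := (@lebesgue_measure R).

(** The Dirichlet condition is known only strictly between the vertical sides, so slices are
    compared on the open interval. *)
Lemma le_Rintegral_oo (f g : R -> R) (c d : R) :
  mu.-integrable `[c, d] (EFin \o f) -> mu.-integrable `[c, d] (EFin \o g) ->
  (forall x, c < x < d -> f x <= g x) ->
  \int[mu]_(x in `[c, d]) f x <= \int[mu]_(x in `[c, d]) g x.
Proof.
move=> jf jg fg.
have sub1 : [set` `]c, d]] `<=` [set` `[c, d]] by exact: subset_itv_oc_cc.
have sub2 : [set` `]c, d[] `<=` [set` `[c, d]] by exact: subset_itv_oo_cc.
have oc (k : R -> R) : mu.-integrable `[c, d] (EFin \o k) ->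
    \int[mu]_(x in `[c, d]) k x = \int[mu]_(x in `]c, d[) k x.
  move=> jk; rewrite -Rintegral_itv_obnd_cbnd; last exact: integrableS jk.
  by rewrite -Rintegral_itv_bndo_bndc//; exact: integrableS jk.
rewrite !oc//; apply: le_Rintegral; [exact: measurable_itv|exact: integrableS jf|exact: integrableS jg|].
by move=> x /=; rewrite in_itv /=; exact: fg.
Qed.

Context (Phi A B : R * R -> R) (h1 h2 al al1 : R -> R) (a b kap t K dl : R).
Context (cPhi : continuous Phi) (cA : continuous A) (cB : continuous B).
Context (dPhix : forall x y : R,
  has_deriv (fun x => Phi (x, y)) x (A (x, y) + B (x, y) * (kap * h1 x))).
Context (dPhiy : forall x y : R, has_deriv (fun y => Phi (x, y)) y (B (x, y))).
Context (dh1 : forall x : R, has_deriv h1 x (h2 x)).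
Context (dal : forall x : R, has_deriv al x (al1 x)).
Context (ch2 : continuous h2) (cal1 : continuous al1).
Context (ab : a < b) (kap01 : 0 <= kap <= 1) (t01 : 0 <= t <= 1).
Context (h1_le1 : forall x, a < x < b -> `|h1 x| <= 1).
Context (h2_le1 : forall x, a < x < b -> `|h2 x| <= 1).
Context (al_leK : forall x, a < x < b -> `|al x| <= K).
Context (dl_le : forall x, a < x < b ->
  dl <= 3 / 8 * t * h1 x ^+ 2 - t ^+ 2 * (h1 x ^+ 2 + h2 x ^+ 2) - al1 x).
Context (Phi_bot : forall x, a < x < b -> Phi (x, 0) = 0).
Context (Phi_top : forall x, a < x < b -> Phi (x, pi) = 0).
Context (h1a : h1 a = 0) (h1b : h1 b = 0).

Let ch1 : continuous h1. Proof. move=> x; exact: has_deriv_cont (dh1 x). Qed.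
Let cal : continuous al. Proof. move=> x; exact: has_deriv_cont (dal x). Qed.

Let ctau (s : R) : continuous (tau s). Proof. by rewrite /tau; cont. Qed.
Let p s (z : R * R) := - kap * t * h1 z.1 * cos (tau s z.2) + kap ^+ 2 * al z.1.
Let px s (z : R * R) := - kap * t * h2 z.1 * cos (tau s z.2) + kap ^+ 2 * al1 z.1.
Let Wx s (z : R * R) := px s z * Phi z ^+ 2 +
  p s z * (2 * Phi z * (A z + B z * (kap * h1 z.1))).

Let cWx s : continuous (Wx s).
Proof.
by have cts := @ctau s; rewrite /Wx /px /p; cont.
Qed.

Let dpx s (x y : R) : has_deriv (fun x => p s (x, y)) x (px s (x, y)).
Proof.
rewrite /p /px /=; apply: has_deriv_eq.
  apply: derD; apply: derM; [|exact: der_cst|exact: der_cst|exact: dal].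
  by apply: derM; [exact: der_cst|exact: dh1].
by rewrite /=; ring.
Qed.

Let dWx s (x y : R) : has_deriv (fun x => p s (x, y) * Phi (x, y) ^+ 2) x (Wx s (x, y)).
Proof.
apply: has_deriv_eq.
  apply: derM; first exact: dpx.
  by apply: derM; exact: dPhix.
by rewrite /Wx /=; ring.
Qed.

Let e := kap ^+ 2 * dl - kap ^+ 3 * (1 + K) ^+ 2.

Let slice_ineq s x : 2^-1 <= s < 1 -> a < x < b ->
  \int[mu]_(y in `[0, pi]) Wx s (x, y) +
    (s ^+ 2 + e) * \int[mu]_(y in `[0, pi]) Phi (x, y) ^+ 2 <=
  \int[mu]_(y in `[0, pi]) (A (x, y) ^+ 2 + B (x, y) ^+ 2).
Proof.
move=> s1 xab.
have cAx : continuous (fun y => A (x, y)) by cont.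
have cBx : continuous (fun y => B (x, y)) by cont.
apply: le_trans (slice_inequality (al1 x) cAx cBx (dPhiy x) kap01 t01 s1
  (h1_le1 xab) (h2_le1 xab) (al_leK xab) (Phi_bot xab) (Phi_top xab)).
rewrite lerD2l ler_wpM2r//.
  by apply: Rintegral_ge0 => y _; exact: sqr_ge0.
by rewrite /e addrA lerD2r lerD2l ler_wpM2l ?sqr_ge0//; exact: dl_le.
Qed.

(** Integrating in x first turns [Wx] into the increment of p Phi^2. As G' vanishes at both ends of
    the cell, only the alpha part of p survives there, and it depends neither on y nor on [s]. Then
    [s] tends to 1. *)
Lemma cell_inequality :
  (1 + kap ^+ 2 * dl - kap ^+ 3 * (1 + K) ^+ 2) *
    \int[mu]_(x in `[a, b]) \int[mu]_(y in `[0, pi]) Phi (x, y) ^+ 2 +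
  kap ^+ 2 * (al b * \int[mu]_(y in `[0, pi]) Phi (b, y) ^+ 2
            - al a * \int[mu]_(y in `[0, pi]) Phi (a, y) ^+ 2) <=
  \int[mu]_(x in `[a, b]) \int[mu]_(y in `[0, pi]) (A (x, y) ^+ 2 + B (x, y) ^+ 2).
Proof.
pose J := \int[mu]_(x in `[a, b]) \int[mu]_(y in `[0, pi]) Phi (x, y) ^+ 2.
pose L := \int[mu]_(x in `[a, b]) \int[mu]_(y in `[0, pi]) (A (x, y) ^+ 2 + B (x, y) ^+ 2).
pose Bd := kap ^+ 2 * (al b * \int[mu]_(y in `[0, pi]) Phi (b, y) ^+ 2
            - al a * \int[mu]_(y in `[0, pi]) Phi (a, y) ^+ 2).
have J0 : 0 <= J.
  by apply: Rintegral_ge0 => x _; apply: Rintegral_ge0 => y _; exact: sqr_ge0.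
have cP2 : continuous (fun z => Phi z ^+ 2) by cont.
have cAB : continuous (fun z => A z ^+ 2 + B z ^+ 2) by cont.
have key s : 2^-1 <= s < 1 -> (s ^+ 2 + e) * J + Bd <= L.
  move=> s1; have cWs := @cWx s.
  have WxE : \int[mu]_(x in `[a, b]) \int[mu]_(y in `[0, pi]) Wx s (x, y) = Bd.
    rewrite Fubini_rect//.
    have E y : \int[mu]_(x in `[a, b]) Wx s (x, y) =
      kap ^+ 2 * al b * Phi (b, y) ^+ 2 - kap ^+ 2 * al a * Phi (a, y) ^+ 2.
      rewrite (Rintegral_derive ab (fun x _ => dWx s x y)).
        by rewrite /p /= h1a h1b !(mulr0, mul0r, add0r).
      by apply: continuous_subspaceT; cont.
    under eq_Rintegral do rewrite E.
    have iPx x r : mu.-integrable `[0, pi] (EFin \o fun y => r * Phi (x, y) ^+ 2).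
      by apply: continuous_integrable; cont.
    have iPx' x : mu.-integrable `[0, pi] (EFin \o fun y => Phi (x, y) ^+ 2).
      by apply: continuous_integrable; cont.
    by rewrite RintegralB// !RintegralZl// /Bd mulrBr !mulrA.
  rewrite addrC -WxE /J -RintegralZl; [|exact: measurable_itv|exact: (continuous2_integrable1 _ _ _ _ cP2)].
  have i1 := continuous2_integrable1 a b 0 pi cWs.
  have i2 := continuous2_integrable1 a b 0 pi cP2.
  have i3 := continuous2_integrable1 a b 0 pi cAB.
  have i2' : mu.-integrable `[a, b] (EFin \o fun x =>
      (s ^+ 2 + e) * \int[mu]_(y in `[0, pi]) Phi (x, y) ^+ 2).
    by apply: (integrableZl _ (s ^+ 2 + e) i2).
  rewrite -RintegralD; [|exact: measurable_itv|exact: i1|exact: i2'].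
  apply: le_Rintegral_oo; [exact: (integrableD _ i1 i2')|exact: i3|].
  by move=> x xab; exact: slice_ineq.
rewrite -/J -/L -/Bd -[X in X * J]addrA -/e.
apply/ler_addgt0Pr => ep ep0.
(* For s >= 1 - d the loss in s^2 J is at most 2 d J <= ep; J + 1 avoids a division by zero. *)
pose d := ep / (2 * (J + 1)).
have d0 : 0 < d by rewrite divr_gt0// mulr_gt0//; lra.
pose s := Num.max 2^-1 (1 - d).
have s1 : 2^-1 <= s < 1 by rewrite le_max lexx /= gt_max; apply/andP; split; lra.
have sd : 1 - d <= s by rewrite le_max lexx orbT.
have := key s s1.
have : 2 * d * J <= ep.
  have J1 : 0 < J + 1 by lra.
  have -> : 2 * d * J = ep * (J / (J + 1)) by rewrite /d; field; rewrite gt_eqF.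
  by apply: ler_piMr; [exact: ltW|rewrite ler_pdivrMr//; lra].
have : (1 - 2 * d) * J <= s ^+ 2 * J.
  by rewrite ler_wpM2r//; move/andP: s1 => [? ?]; nra.
by move=> *; lra.
Qed.

End Cell.

(** * Energy on the waveguide *)

Section Domain.
Context {R : realType}.
Notation mu := (@lebesgue_measure R).
Context (l kap : R) (g : R -> R) (w : nat -> R) (N : nat).
Context (l0 : 0 < l) (cg : continuous g).
Context (g_out : forall x, ~~ (0 < x < l) -> g x = 0).

(** Stands in for [G] on ]0, N l[, where only the sites 0, ..., N - 1 contribute. *)
Definition profile (x : R) : R := \sum_(k < N) w k * g (x - k%:R * l).

Lemma profile_cell k x : (k < N)%N -> k%:R * l <= x <= k.+1%:R * l ->
  profile x = w k * g (x - k%:R * l).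
Proof.
move=> kN /andP[kx xk]; rewrite /profile (bigD1 (Ordinal kN))//= big1 ?addr0//.
move=> i ik; have {ik}ik : (i != k :> nat)%N by [].
rewrite g_out ?mulr0//; apply/negP => /andP[x1 x2].
have [ltik|ltki|/eqP] := ltngtP i k; last by rewrite (negbTE ik).
- have : i.+1%:R * l <= k%:R * l by rewrite ler_pM2r// ler_nat.
  by rewrite -natr1 mulrDl mul1r => ?; lra.
- have : k.+1%:R * l <= i%:R * l by rewrite ler_pM2r// ler_nat.
  by move=> ?; lra.
Qed.

Lemma continuous_profile : continuous profile.
Proof.
have c i : continuous (fun x => w i * g (x - i%:R * l)) by cont.
rewrite /profile; elim: N => [|n IH].
  by under eq_fun do rewrite big_ord0; exact: cont_cst.
under eq_fun do rewrite big_ord_recr /=.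
exact: contD.
Qed.

Let D : set (R * R) := [set x | 0 < x.1 < N%:R * l /\
  kap * profile x.1 < x.2 < kap * profile x.1 + pi].

Let cP : continuous profile := continuous_profile.

Lemma open_domain : open D.
Proof.
have gt0_open (f : R * R -> R) : continuous f -> open [set x | 0 < f x].
  move=> cf; rewrite (_ : [set x | _] = f @^-1` `]0, +oo[).
    by apply: open_comp => [x _|]; [exact: cf|exact: interval_open].
  by apply/seteqP; split => x /=; rewrite in_itv /= andbT.
have -> : D = [set x | 0 < x.1] `&` [set x | 0 < N%:R * l - x.1] `&`
  [set x | 0 < x.2 - kap * profile x.1] `&`
  [set x | 0 < kap * profile x.1 + pi - x.2].
  apply/seteqP; split => [x [/andP[? ?] /andP[? ?]]|x [[[/= ? ?] ?] ?]].
    by split; [split; [split|]|]; rewrite /= ?subr_gt0.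
  by split; apply/andP; split; lra.
by repeat apply: openI; apply: gt0_open; cont.
Qed.

(** Each vertical section is a translate of ]0, pi[, so Tonelli and translation invariance
    straighten the domain without a Jacobian; closing the intervals adds null sets. *)
Lemma integral_domain (f : R * R -> R) : continuous f -> (forall x, 0 <= f x) ->
  (\int[mu \x mu]_(x in D) (f x)%:E =
   (\int[mu]_(x in `[0, (N%:R * l)%R])
      \int[mu]_(y in `[0%R, pi]) f (x, y + kap * profile x)%R)%:E)%E.
Proof.
move=> cf f0.
have mD : measurable D := open_measurable2 open_domain.
have mfD : measurable_fun setT ((EFin \o f) \_ D).
  apply/(measurable_restrictT _ mD); apply: measurable_funTS.
  by apply/measurable_EFinP; exact: continuous_measurable_fun2.
have f0D x : (0 <= ((EFin \o f) \_ D) x)%E.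
  by rewrite patchE; case: ifP => // _; rewrite lee_fin f0.
pose H x := \int[mu]_(y in `[0, pi]) f (x, y + kap * profile x).
have cfT : continuous (fun z => f (z.1, z.2 + kap * profile z.1)) by cont.
have iH := continuous2_integrable1 0 (N%:R * l) 0 pi cfT.
have E x : fubini_F mu ((EFin \o f) \_ D) x = ((EFin \o H) \_ `]0, N%:R * l[) x.
  rewrite /fubini_F patchE mem_setE in_itv /=; case: ifPn => x0; last first.
    apply: integral0_eq => y _; rewrite patchE memNset// => -[/= xN].
    by rewrite xN in x0.
  have c1 : continuous (fun y => f (x, y)) by cont.
  have c2 : continuous (fun y => f (x, y + kap * profile x)) by cont.
  rewrite /= /H /Rintegral fineK; last first.
    by apply: integrable_fin_num => //; exact: continuous_integrable.
  have := integral_shift (kap * profile x) (ltW (@pi_gt0 R)) c1.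
  rewrite add0r => <-.
  have m1 A : measurable_fun A (EFin \o fun y => f (x, y)).
    by apply: measurable_funTS; apply/measurable_EFinP; exact: continuous_measurable_fun.
  rewrite -integral_itv_obnd_cbnd; last exact: m1.
  rewrite -integral_itv_bndo_bndc; last exact: m1.
  rewrite [RHS]integral_mkcond; apply: eq_integral => y _.
  rewrite !patchE mem_setE in_itv /= [pi + _]addrC; congr (if _ then _ else _).
  by apply/idP/idP; [rewrite inE => -[]|move=> ?; rewrite inE; split].
rewrite integral_mkcond.
have -> : (\int[mu \x mu]_x ((EFin \o f) \_ D) x = \int[mu]_x fubini_F mu ((EFin \o f) \_ D) x)%E.
  exact: fubini_tonelli1.
rewrite /Rintegral fineK; last exact: integrable_fin_num iH.
have -> : (\int[mu]_x fubini_F mu ((EFin \o f) \_ D) x =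
    \int[mu]_x ((EFin \o H) \_ `]0%R, (N%:R * l)%R[) x)%E.
  by apply: eq_integral => x _; exact: E.
rewrite -integral_mkcond.
have mH A : A `<=` `[0, N%:R * l] -> measurable A -> measurable_fun A (EFin \o H).
  move=> AH mA; case/integrableP : iH => mH _.
  exact: measurable_funS mH.
rewrite integral_itv_bndo_bndc; last first.
  by apply: mH => //; exact: subset_itv_oo_cc.
rewrite integral_itv_obnd_cbnd//.
by apply: mH => //; exact: subset_itv_oc_cc.
Qed.

Lemma Rintegral_domain_cells (f : R * R -> R) n : continuous f -> (n <= N)%N ->
  \int[mu]_(x in `[0, n%:R * l])
      \int[mu]_(y in `[0, pi]) f (x, y + kap * profile x) =
  \sum_(k < n) \int[mu]_(x in `[k%:R * l, k.+1%:R * l])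
      \int[mu]_(y in `[0, pi]) f (x, y + kap * (w k * g (x - k%:R * l))).
Proof.
move=> cf; have cfT : continuous (fun z => f (z.1, z.2 + kap * profile z.1)) by cont.
elim: n => [_|n IH nN]; first by rewrite big_ord0 mul0r set_itv1 Rintegral_set1.
have iH a b := continuous2_integrable1 a b 0 pi cfT.
have ln : n%:R * l <= n.+1%:R * l by rewrite ler_pM2r// ler_nat.
rewrite big_ord_recr /= -(IH (ltnW nN)).
have := @Rintegral_itvB R (fun x => \int[mu]_(y in `[0, pi]) f (x, y + kap * profile x))
  (BLeft 0) (BRight (n.+1%:R * l)) (n%:R * l) (iH _ _).
rewrite !bnd_simp ln mulr_ge0 ?ler0n ?(ltW l0)// => /(_ erefl erefl) /eqP.
rewrite subr_eq => /eqP ->; rewrite [LHS]addrC; congr +%R.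
rewrite Rintegral_itv_obnd_cbnd; last first.
  by apply: integrableS (iH (n%:R * l) (n.+1%:R * l)) => //; exact: subset_itv_oc_cc.
apply: eq_Rintegral => x; rewrite inE /= in_itv /= => xn.
by apply: eq_Rintegral => y _; rewrite (profile_cell nN xn).
Qed.

Context (g1 g2 V v : R -> R) (t M m dl A : R) (al : nat -> R).
Context (dg : forall x, has_deriv g x (g1 x)) (dg1 : forall x, has_deriv g1 x (g2 x)).
Context (cg2 : continuous g2) (dV : forall x, has_deriv V x (v x)) (cv : continuous v).
Context (g1_out : forall x, ~~ (0 < x < l) -> g1 x = 0).
Context (g1_le1 : forall x, `|g1 x| <= 1) (g2_le1 : forall x, `|g2 x| <= 1).
Context (vE : forall x, v x = 3 / 8 * t * g1 x ^+ 2 - t ^+ 2 * (g1 x ^+ 2 + g2 x ^+ 2)).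
Context (V_leM : forall x, 0 <= x <= l -> `|V x| <= M) (V0 : V 0 = 0) (Vl : V l = m).
Context (kap01 : 0 <= kap <= 1) (t01 : 0 <= t <= 1) (dl0 : 0 <= dl).
Context (w01 : forall k, (k < N)%N -> 0 <= w k <= 1).
Context (al_leA : forall k, (k <= N)%N -> `|al k| <= A).
Context (al0 : al 0%N <= 0) (alN : 0 <= al N).
Context (al_step : forall k, (k < N)%N -> al k.+1 <= al k + w k ^+ 2 * m - dl * l).
Context (phi : R * R -> R) (phi1 : C1 phi).
Context (phi0 : forall x, 0 < x.1 < N%:R * l ->
  x.2 = kap * profile x.1 \/ x.2 = kap * profile x.1 + pi -> phi x = 0).

Let cphi : continuous phi. Proof. exact: C1_continuous. Qed.
Let cd1 : continuous (d1 phi). Proof. by case: phi1. Qed.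
Let cd2 : continuous (d2 phi). Proof. by case: phi1. Qed.

Let E := 1 + kap ^+ 2 * dl - kap ^+ 3 * (1 + (A + M + dl * l)) ^+ 2.

Let Bd k := \int[mu]_(y in `[0, pi]) phi (k%:R * l, y) ^+ 2.

(** At the right end alpha has reached al k + w_k^2 m - dl l, because V l = m; the next cell
    restarts from [al k.+1]. The bump vanishes at the ends of a cell, so neighbouring cells share
    the trace [Bd]. *)
Lemma cell_energy k : (k < N)%N ->
  E * \int[mu]_(x in `[k%:R * l, k.+1%:R * l]) \int[mu]_(y in `[0, pi])
        phi (x, y + kap * (w k * g (x - k%:R * l))) ^+ 2 +
  kap ^+ 2 * ((al k + w k ^+ 2 * m - dl * l) * Bd k.+1 - al k * Bd k) <=
  \int[mu]_(x in `[k%:R * l, k.+1%:R * l]) \int[mu]_(y in `[0, pi])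
        (d1 phi (x, y + kap * (w k * g (x - k%:R * l))) ^+ 2 +
         d2 phi (x, y + kap * (w k * g (x - k%:R * l))) ^+ 2).
Proof.
move=> kN; set a := k%:R * l; set b := k.+1%:R * l.
have aE : a = k%:R * l by []; have bE : b = k.+1%:R * l by [].
have ba : b - a = l by rewrite aE bE -natr1; ring.
clearbody a b.
have wk := w01 kN; have [wk0 wk1] := andP wk.
have wk2 : 0 <= w k ^+ 2 <= 1 by rewrite sqr_ge0 expr_le1.
pose h x := w k * g (x - a).
have dsh (f f' : R -> R) x : has_deriv f (x - a) (f' (x - a)) ->
    has_deriv (fun x => f (x - a)) x (f' (x - a)).
  move=> df; apply: has_deriv_eq.
    apply: (@der_comp R f (fun x => x - a) x _ _ df).
    by apply: derD; [exact: der_id|exact: der_cst].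
  by rewrite addr0 mulr1.
have dscale (f f' : R -> R) x : has_deriv f (x - a) (f' (x - a)) ->
    has_deriv (fun x => w k * f (x - a)) x (w k * f' (x - a)).
  move=> df; apply: has_deriv_eq.
    by apply: derM; [exact: der_cst|exact: dsh df].
  by rewrite mulr0 addr0.
have dh x : has_deriv h x (w k * g1 (x - a)) by exact: dscale (dg _).
have ch : continuous h by move=> x; exact: has_deriv_cont (dh x).
(* Chosen so that w_k^2 v - alpha' is the constant [dl]: alpha absorbs the variation of the
   effective potential inside the cell. Its three terms are bounded by [A], [M] and dl l, whence the
   constant A + M + dl l. *)
pose alx x := al k + w k ^+ 2 * V (x - a) - dl * (x - a).
pose alx1 x := w k ^+ 2 * v (x - a) - dl.
have dalx x : has_deriv alx x (alx1 x).
  apply: has_deriv_eq.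
    apply: derD; first apply: derD; first exact: der_cst.
      by apply: derM; [exact: der_cst|exact: dsh (dV _)].
    apply: derN; apply: derM; first exact: der_cst.
    by apply: derD; [exact: der_id|exact: der_cst].
  by rewrite /alx1; ring.
have := @cell_inequality R (fun z => phi (z.1, z.2 + kap * h z.1))
  (fun z => d1 phi (z.1, z.2 + kap * h z.1)) (fun z => d2 phi (z.1, z.2 + kap * h z.1))
  (fun x => w k * g1 (x - a)) (fun x => w k * g2 (x - a)) alx alx1 a b kap t
  (A + M + dl * l) dl.
have Ea : alx a = al k by rewrite /alx subrr V0 !mulr0 addr0 subr0.
have Eb : alx b = al k + w k ^+ 2 * m - dl * l by rewrite /alx ba Vl.
have Pa : \int[mu]_(y in `[0, pi]) phi (a, y + kap * h a) ^+ 2 = Bd k.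
  rewrite /Bd -aE; apply: eq_Rintegral => y _; rewrite /h subrr g_out ?ltxx// !mulr0 addr0//.
have Pb : \int[mu]_(y in `[0, pi]) phi (b, y + kap * h b) ^+ 2 = Bd k.+1.
  rewrite /Bd -bE; apply: eq_Rintegral => y _; rewrite /h ba g_out ?ltxx ?andbF// !mulr0 addr0//.
rewrite /= Ea Eb Pa Pb; apply.
- by cont.
- by cont.
- by cont.
- move=> x y; apply: (@C1_curve_derive _ phi (fun x => y + kap * h x)); first exact: phi1.
  apply: has_deriv_eq.
    by apply: derD; [exact: der_cst|apply: derM; [exact: der_cst|exact: dh]].
  by rewrite mulr0 add0r addr0.
- move=> x y; have [_ dy _ _] := phi1.
  apply: has_deriv_eq.
    apply: (@der_comp _ (fun y => phi (x, y)) (fun y => y + kap * h x)).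
      exact: derivable1_slice2 (dy _).
    by apply: derD; [exact: der_id|exact: der_cst].
  by rewrite addr0 mulr1.
- by move=> x; exact: dscale (dg1 _).
- exact: dalx.
- by cont.
- by rewrite /alx1; cont.
- by rewrite -subr_gt0 ba.
- by [].
- by [].
- by move=> x _; rewrite normrM (ger0_norm wk0) mulr_ile1.
- by move=> x _; rewrite normrM (ger0_norm wk0) mulr_ile1.
- move=> x /andP[ax xb]; rewrite /alx.
  apply: le_trans (ler_normB _ _) _; apply: lerD; last first.
    by rewrite ger0_norm ?mulr_ge0//; [apply: ler_wpM2l => //; lra|lra].
  apply: le_trans (ler_normD _ _) _; apply: lerD.
    by apply: al_leA; exact: ltnW.
  have VM : `|V (x - a)| <= M by apply: V_leM; apply/andP; split; lra.
  rewrite normrM ger0_norm ?sqr_ge0//.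
  apply: le_trans VM; apply: ler_piMl => //; by case/andP: wk2.
- by move=> x _; rewrite /alx1 vE; rewrite le_eqVlt; apply/orP; left; apply/eqP; ring.
- move=> x axb; apply: phi0 => /=.
    have lk : b <= N%:R * l by rewrite bE ler_pM2r// ler_nat.
    have a0 : 0 <= a by rewrite aE mulr_ge0 ?(ltW l0).
    by move/andP: axb => [? ?]; apply/andP; split; lra.
  left; rewrite add0r (@profile_cell k)// -?aE// -bE.
  by move/andP: axb => [/ltW -> /ltW ->].
- move=> x axb; apply: phi0 => /=.
    have lk : b <= N%:R * l by rewrite bE ler_pM2r// ler_nat.
    have a0 : 0 <= a by rewrite aE mulr_ge0 ?(ltW l0).
    by move/andP: axb => [? ?]; apply/andP; split; lra.
  right; rewrite addrC (@profile_cell k)// -?aE// -bE.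
  by move/andP: axb => [/ltW -> /ltW ->].
- by rewrite subrr g1_out ?ltxx// mulr0.
- by rewrite ba g1_out ?ltxx ?andbF// mulr0.
Qed.

(** By [al_step] alpha only jumps downwards at a cell boundary, so the boundary terms dominate a
    telescoping sum, which is al N Bd N - al 0 Bd 0 >= 0 by the signs at the two Neumann sides. *)
Lemma domain_energy :
  (E%:E * \int[mu \x mu]_(x in D) (phi x ^+ 2)%:E <=
   \int[mu \x mu]_(x in D) (d1 phi x ^+ 2 + d2 phi x ^+ 2)%:E)%E.
Proof.
have cp2 : continuous (fun x => phi x ^+ 2) by cont.
have cg12 : continuous (fun x => d1 phi x ^+ 2 + d2 phi x ^+ 2) by cont.
rewrite integral_domain//; last by move=> x; exact: sqr_ge0.
rewrite integral_domain//; last by move=> x; rewrite addr_ge0 ?sqr_ge0.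
rewrite -EFinM lee_fin (Rintegral_domain_cells cp2 (leqnn N)).
rewrite (Rintegral_domain_cells cg12 (leqnn N)) mulr_sumr.
pose S k := kap ^+ 2 * ((al k + w k ^+ 2 * m - dl * l) * Bd k.+1 - al k * Bd k).
have Bd0 k : 0 <= Bd k by apply: Rintegral_ge0 => y _; exact: sqr_ge0.
have S0 : 0 <= \sum_(k < N) S k.
  rewrite -mulr_sumr mulr_ge0 ?sqr_ge0//.
  apply: (@le_trans _ _ (\sum_(k < N) (al k.+1 * Bd k.+1 - al k * Bd k))).
    rewrite -(big_mkord xpredT (fun k => al k.+1 * Bd k.+1 - al k * Bd k)).
    rewrite telescope_sumr// subr_ge0.
    apply: (@le_trans _ _ 0); last exact: mulr_ge0.
    by rewrite mulr_le0_ge0.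
  apply: ler_sum => k _; rewrite lerD2r ler_wpM2r//.
  exact: al_step.
rewrite -[leLHS]addr0; apply: le_trans (lerD (lexx _) S0) _.
rewrite -big_split /=; apply: ler_sum => k _.
exact: cell_energy.
Qed.

End Domain.

(** * Lower bounds for eigenvalues *)

Section Spectral.
Context {R : realType}.
Notation mu2 := (@lebesgue_measure R \x @lebesgue_measure R)%E.
Context (D : set (R * R)) (mD : measurable D).
Implicit Types f h u : R * R -> R.

Definition energy f : \bar R := (\int[mu2]_(x in D) (f x ^+ 2)%:E)%E.

Lemma energy_ge0 f : (0 <= energy f)%E.
Proof. by apply: integral_ge0 => x _; rewrite lee_fin sqr_ge0. Qed.

Lemma measurable_fun_sqr f : measurable_fun D f ->
  measurable_fun D (fun x => (f x ^+ 2)%:E).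
Proof. by move=> mf; apply/measurable_EFinP; exact: measurable_funX. Qed.

Lemma energy_subC f h : energy (f \- h)%R = energy (h \- f)%R.
Proof. by apply: eq_integral => x _ /=; rewrite -sqrrN opprB. Qed.

(* Young: [(a + b)^2 <= (1 + r) a^2 + (1 + 1 / r) b^2]. *)
Lemma energy_le f h (r : R) : 0 < r -> measurable_fun D f -> measurable_fun D h ->
  (energy f <= (1 + r)%:E * energy h + (1 + r^-1)%:E * energy (f \- h)%R)%E.
Proof.
move=> r0 mf mh; have r1 : 0 < r^-1 by rewrite invr_gt0.
have mfh : measurable_fun D (f \- h) by exact: measurable_funB.
have m1 := measurable_fun_sqr mh; have m2 := measurable_fun_sqr mfh.
rewrite /energy -ge0_integralZl_EFin//; last 2 first.
- by move=> x _; rewrite lee_fin sqr_ge0.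
- by lra.
rewrite -ge0_integralZl_EFin//; last 2 first.
- by move=> x _; rewrite lee_fin sqr_ge0.
- by lra.
rewrite -ge0_integralD//; last 4 first.
- by move=> x _; rewrite -EFinM lee_fin mulr_ge0 ?sqr_ge0//; lra.
- exact: measurable_funeM.
- by move=> x _; rewrite -EFinM lee_fin mulr_ge0 ?sqr_ge0//; lra.
- exact: measurable_funeM.
apply: ge0_le_integral => //.
- by move=> x _; rewrite lee_fin sqr_ge0.
- exact: measurable_fun_sqr.
- by apply: emeasurable_funD; exact: measurable_funeM.
move=> x _; rewrite -!EFinM -EFinD lee_fin /=.
have := mulr_ge0 (ltW r1) (sqr_ge0 (f x - h x - r * h x)).
have rr : r^-1 * r = 1 by rewrite mulVf// gt_eqF.
suff -> : r^-1 * (f x - h x - r * h x) ^+ 2 =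
  r^-1 * (f x - h x) ^+ 2 - 2 * (r^-1 * r) * (f x - h x) * h x +
  (r^-1 * r) * r * h x ^+ 2 by rewrite rr => ?; lra.
by ring.
Qed.

Lemma L2_measurable u : L2 D u -> measurable_fun D u.
Proof.
move=> /andP[/set_mem mu _]; apply: eq_measurable_fun (measurable_funTS mu).
by move=> x xD; rewrite patchE xD.
Qed.

Lemma Lnorm2_energy f :
  ('N[lebesgue2]_2%:E[EFin \o (f \_ D)] `^ 2 = energy f)%E.
Proof.
rewrite poweR_Lnorm// /energy [RHS]integral_mkcond; apply: eq_integral => x _.
rewrite /= !patchE; case: ifPn => _; rewrite ?normr0 /=.
  by rewrite powR_mulrn// real_normK// num_real.
by rewrite powR0// pnatr_eq0.
Qed.

Lemma L2_energy u : L2 D u -> energy u \is a fin_num.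
Proof.
move=> /andP[_ /set_mem fu]; rewrite ge0_fin_numE ?energy_ge0//.
by rewrite -Lnorm2_energy poweR_lty.
Qed.

Lemma integrable_sqr f : measurable_fun D f -> energy f \is a fin_num ->
  mu2.-integrable D (fun x => (f x ^+ 2)%:E).
Proof.
move=> mf; rewrite ge0_fin_numE ?energy_ge0// => Ef.
apply/integrableP; split; first exact: measurable_fun_sqr.
apply: le_lt_trans Ef; rewrite le_eqVlt; apply/orP; left; apply/eqP.
by apply: eq_integral => x _; rewrite /= ger0_norm ?sqr_ge0.
Qed.

Lemma L2_cvg_small (phi : nat -> R * R -> R) u (e : R) : 0 < e -> L2_cvg D phi u ->
  \forall n \near \oo, (energy (phi n \- u)%R <= e%:E)%E.
Proof.
move=> e0 cv; have d0 : 0 < Num.sqrt e by rewrite sqrtr_gt0.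
have : nbhs (0%E : \bar R) [set x | (x < (Num.sqrt e)%:E)%E].
  by apply: open_nbhs_nbhs; split; [exact: open_ereal_lt_ereal|rewrite /= lte_fin].
move=> /cv Hn; near=> n.
have Ln : ('N[lebesgue2]_2%:E[EFin \o ((phi n \- u) \_ D)%R] < (Num.sqrt e)%:E)%E.
  by near: n; exact: Hn.
rewrite -Lnorm2_energy.
have -> : e%:E = ((Num.sqrt e)%:E `^ 2)%E.
  by rewrite poweR_EFin powR_mulrn ?sqrtr_ge0// sqr_sqrtr// ltW.
apply: gt0_ler_poweR => //.
- by rewrite in_itv /= leey Lnorm_ge0.
- by rewrite in_itv /= leey lee_fin sqrtr_ge0.
- exact: ltW Ln.
Unshelve. all: by end_near. Qed.

(** Testing the weak equation with [u] itself equates the energy of the weak gradient with [lam]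
    times that of [u]. The inequality for C^1 functions passes to [u] along the approximating
    sequence by Young's inequality, applied between [u] and [phi n] and between each derivative and
    its limit. *)
Lemma eigenvalue_ge (Gamma : set (R * R)) (E lam : R) : 0 <= E ->
  (forall phi, C1 phi -> (forall x, Gamma x -> phi x = 0) ->
     (E%:E * energy phi <= energy (d1 phi) + energy (d2 phi))%E) ->
  is_eigenvalue D Gamma lam -> E <= lam.
Proof.
move=> E0 HE [u [u_neq0 [_ [v1 [v2 [fd weak]]]]]].
have [Lu Lv1 Lv2 [phi [phiC cu cv1 cv2]]] := fd.
have mu := L2_measurable Lu; have mv1 := L2_measurable Lv1.
have mv2 := L2_measurable Lv2.
have fu := L2_energy Lu; have fv1 := L2_energy Lv1; have fv2 := L2_energy Lv2.
pose su := fine (energy u); pose s1 := fine (energy v1); pose s2 := fine (energy v2).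
have suE : energy u = su%:E by rewrite fineK.
have s1E : energy v1 = s1%:E by rewrite fineK.
have s2E : energy v2 = s2%:E by rewrite fineK.
have s10 : 0 <= s1 by rewrite -lee_fin -s1E energy_ge0.
have s20 : 0 <= s2 by rewrite -lee_fin -s2E energy_ge0.
have su0 : 0 < su.
  rewrite -lte_fin -suE lt_neqAle energy_ge0 andbT eq_sym; apply/eqP => e0.
  apply: u_neq0.
  have := (ae_eq_integral_abs mu2 mD (measurable_fun_sqr mu)).1.
  have -> : (\int[mu2]_(x in D) `|(u x ^+ 2)%:E|)%E = energy u.
    by apply: eq_integral => x _; rewrite /= ger0_norm ?sqr_ge0.
  move=> /(_ e0); apply: filterS => x xD Dx.
  by have := xD Dx => /= -[] /eqP; rewrite sqrf_eq0 => /eqP.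
have wE : s1 + s2 = lam * su.
  have := weak u v1 v2 fd.
  have i1 : mu2.-integrable D (fun x => (v1 x ^+ 2)%:E).
    exact: integrable_sqr.
  have i2 : mu2.-integrable D (fun x => (v2 x ^+ 2)%:E).
    exact: integrable_sqr.
  have iu : mu2.-integrable D (fun x => (u x ^+ 2)%:E).
    exact: integrable_sqr.
  have -> : \int[lebesgue2]_(x in D) (v1 x * v1 x + v2 x * v2 x) = s1 + s2.
    exact: (@RintegralD _ _ R mu2 D (fun x => v1 x ^+ 2) (fun x => v2 x ^+ 2) mD i1 i2).
  move=> ->; rewrite -(@RintegralZl _ _ R mu2 D (fun x => u x ^+ 2) lam mD iu).
  by apply: eq_Rintegral => x _; rewrite mulrA.
have key (r e : R) : 0 < r < 1 -> 0 < e ->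
    E * su <= (1 + r) ^+ 2 * (s1 + s2) + ((1 + r) * (1 + r^-1) * 2 + E * (1 + r^-1)) * e.
  move=> /andP[r0 r1] e0; have ri : 0 < r^-1 by rewrite invr_gt0.
  near \oo => n.
  have [phin phi0] := phiC n.
  have [_ _ cd1 cd2] := phin.
  have mphi : measurable_fun D (phi n).
    by apply: measurable_funTS; apply: continuous_measurable_fun2; exact: C1_continuous.
  have md1 : measurable_fun D (d1 (phi n)).
    by apply: measurable_funTS; exact: continuous_measurable_fun2.
  have md2 : measurable_fun D (d2 (phi n)).
    by apply: measurable_funTS; exact: continuous_measurable_fun2.
  have eu : (energy (phi n \- u)%R <= e%:E)%E by near: n; exact: L2_cvg_small.
  have e1 : (energy (d1 (phi n) \- v1)%R <= e%:E)%E.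
    by near: n; exact: (@L2_cvg_small (fun n => d1 (phi n))).
  have e2 : (energy (d2 (phi n) \- v2)%R <= e%:E)%E.
    by near: n; exact: (@L2_cvg_small (fun n => d2 (phi n))).
  have up (a : \bar R) (c d : R) : 0 <= c -> 0 <= d -> (a <= e%:E)%E ->
      (c%:E + d%:E * a <= (c + d * e)%:E)%E.
    by move=> c0 d0 ae; rewrite EFinD EFinM leeD2l// lee_wpmul2l// lee_fin.
  have h1 : (energy (d1 (phi n)) <= ((1 + r) * s1 + (1 + r^-1) * e)%:E)%E.
    apply: le_trans (energy_le r0 md1 mv1) _; rewrite s1E -EFinM.
    by apply: up => //; [rewrite mulr_ge0//|]; lra.
  have h2 : (energy (d2 (phi n)) <= ((1 + r) * s2 + (1 + r^-1) * e)%:E)%E.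
    apply: le_trans (energy_le r0 md2 mv2) _; rewrite s2E -EFinM.
    by apply: up => //; [rewrite mulr_ge0//|]; lra.
  have h3 := HE _ phin phi0.
  have h4 := energy_le r0 mu mphi.
  have E0' : (0 <= E%:E)%E by rewrite lee_fin.
  have := lee_wpmul2l E0' h4; rewrite suE ge0_muleDr; last 2 first.
  - by rewrite mule_ge0 ?energy_ge0// lee_fin; lra.
  - by rewrite mule_ge0 ?energy_ge0// lee_fin; lra.
  rewrite -EFinM muleCA => h5.
  rewrite -lee_fin; apply: le_trans h5 _.
  have h6 : (E%:E * energy (phi n) <=
      ((1 + r) * (s1 + s2) + 2 * ((1 + r^-1) * e))%:E)%E.
    apply: le_trans h3 _; apply: le_trans (leeD h1 h2) _.
    by rewrite -EFinD lee_fin; lra.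
  have r10 : (0 <= (1 + r)%:E)%E by rewrite lee_fin; lra.
  have h7 : ((1 + r^-1)%:E * energy (u \- phi n)%R <= ((1 + r^-1) * e)%:E)%E.
    by rewrite EFinM energy_subC lee_wpmul2l// lee_fin; lra.
  apply: le_trans (leeD (lee_wpmul2l r10 h6) (lee_wpmul2l E0' h7)) _.
  by rewrite -!EFinM -EFinD lee_fin; lra.
(* The coefficient of [e] contains [r^-1], so [e] tends to 0 at fixed [r], and only then does
   [r]. *)
have key2 (r : R) : 0 < r < 1 -> E * su <= (1 + r) ^+ 2 * (s1 + s2).
  move=> r01; apply/ler_addgt0Pr => e e0.
  pose C := (1 + r) * (1 + r^-1) * 2 + E * (1 + r^-1).
  have C0 : 0 <= C.
    move/andP: r01 => [r0 r1]; have ri : 0 < r^-1 by rewrite invr_gt0.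
    by rewrite addr_ge0 ?mulr_ge0//; lra.
  have ec : 0 < e / (C + 1) by rewrite divr_gt0//; lra.
  apply: le_trans (key r _ r01 ec) _; rewrite lerD2l -/C.
  rewrite mulrCA ler_piMr ?(ltW e0)// ler_pdivrMr; lra.
have : E * su <= s1 + s2.
  apply/ler_addgt0Pr => e e0.
  pose r := Num.min (1 / 2) (e / (3 * (s1 + s2 + 1))).
  have p0 : 0 < 3 * (s1 + s2 + 1) by lra.
  have r0 : 0 < r by rewrite lt_min; apply/andP; split; [lra|exact: divr_gt0].
  have r12 : r <= 1 / 2 by rewrite ge_min lexx.
  have re : r * (3 * (s1 + s2 + 1)) <= e.
    by rewrite -ler_pdivlMr// ge_min lexx orbT.
  apply: le_trans (key2 r _) _; first by apply/andP; split; lra.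
  have : (1 + r) ^+ 2 * (s1 + s2) <= (1 + 3 * r) * (s1 + s2).
    by rewrite ler_wpM2r//; [lra|nra].
  by move=> ?; lra.
by rewrite wE ler_pM2r.
Unshelve. all: by end_near. Qed.

Lemma lowest_eigenvalue_ge (Gamma : set (R * R)) (E : R) : 0 <= E ->
  (forall phi, C1 phi -> (forall x, Gamma x -> phi x = 0) ->
     (E%:E * energy phi <= energy (d1 phi) + energy (d2 phi))%E) ->
  (E%:E <= lowest_eigenvalue D Gamma)%E.
Proof.
move=> E0 HE; apply: le_ereal_inf_tmp => _ [lam lamP <-].
by rewrite lee_fin; exact: (eigenvalue_ge E0 HE lamP).
Qed.

End Spectral.

(** * Bump functions *)

Section Bump.
Context {R : realType}.
Notation mu := (@lebesgue_measure R).

Lemma has_deriv_near_cst (f : R -> R) (x r d : R) :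
  (\forall y \near x, f y = r) -> has_deriv f x d -> d = 0.
Proof.
move=> fr [_ <-]; rewrite (near_eq_derive (g := cst r) _ fr).
exact: derive_cst.
Qed.

Lemma sup_norm_ge (l : R) (f : R -> R) x : continuous f -> 0 <= x <= l ->
  `|f x| <= sup_norm l f.
Proof.
move=> cf x0l; apply: ub_le_sup; last by exists x.
have cn : {within `[0, l], continuous (fun x => `|f x|)}.
  apply: continuous_subspaceT => y.
  by apply: (@continuous_comp _ _ _ f (fun y => `|y|)); [exact: cf|exact: norm_continuous].
have l0 : 0 <= l by move/andP: x0l => [? ?]; lra.
have [c _ cP] := EVT_max l0 cn.
by exists `|f c| => _ [y yl <-]; exact: cP.
Qed.

Context (l : R) (g : R -> R) (l1 : 1 <= l) (bump : is_bump l g).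

Let g1 := derive1 g.
Let g2 := derive1 g1.

Lemma bump_deriv x : has_deriv g x (g1 x).
Proof. by have [[dg _ _] _ _ _] := bump; split; [exact: dg|rewrite -derive1E]. Qed.

Lemma bump_deriv2 x : has_deriv g1 x (g2 x).
Proof. by have [[_ dg _] _ _ _] := bump; split; [exact: dg|rewrite -derive1E]. Qed.

Lemma bump_continuous : continuous g.
Proof. move=> x; exact: has_deriv_cont (bump_deriv x). Qed.

Lemma bump_continuous1 : continuous g1.
Proof. move=> x; exact: has_deriv_cont (bump_deriv2 x). Qed.

Lemma bump_continuous2 : continuous g2.
Proof. by have [[_ _ cg] _ _ _] := bump. Qed.

Let C := closure [set x | g x != 0].

Let out x : ~~ (0 < x < l) -> ~ C x.
Proof.
move=> x0 Cx; have [_ _ sub _] := bump.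
by have := sub _ Cx; rewrite /= in_itv /= (negbTE x0).
Qed.

(** Since [C] is closed, vanishing outside [C] holds locally and passes from g to g' and then to
    g''. *)
Let near_out (f : R -> R) x : (forall y, ~ C y -> f y = 0) -> ~ C x ->
  \forall y \near x, f y = 0.
Proof.
move=> f0 Cx; have : nbhs x (~` C).
  by apply: open_nbhs_nbhs; split => //; apply: closed_openC; exact: closed_closure.
by apply: filterS => y; exact: f0.
Qed.

Let out0 x : ~ C x -> g x = 0.
Proof. by move=> Cx; apply/eqP/negPn/negP => gx; apply: Cx; exact: subset_closure. Qed.

Let out1 x : ~ C x -> g1 x = 0.
Proof.
by move=> Cx; exact: has_deriv_near_cst (near_out out0 Cx) (bump_deriv x).
Qed.

Let out2 x : ~ C x -> g2 x = 0.
Proof.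
by move=> Cx; exact: has_deriv_near_cst (near_out out1 Cx) (bump_deriv2 x).
Qed.

Lemma bump_out x : ~~ (0 < x < l) -> g x = 0.
Proof. by move=> /out /out0. Qed.

Lemma bump_out1 x : ~~ (0 < x < l) -> g1 x = 0.
Proof. by move=> /out /out1. Qed.

Lemma bump_out2 x : ~~ (0 < x < l) -> g2 x = 0.
Proof. by move=> /out /out2. Qed.

Let maxE : Num.max (sup_norm l g) (Num.max (sup_norm l g1) (sup_norm l g2)) = 1.
Proof. by have [_ _ _ ->] := bump. Qed.

Let le1 (f : R -> R) : continuous f -> (forall x, ~~ (0 < x < l) -> f x = 0) ->
  sup_norm l f <= 1 -> forall x, `|f x| <= 1.
Proof.
move=> cf f0 f1 x; have [x0l|/f0 ->] := boolP (0 < x < l); last by rewrite normr0.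
apply: le_trans f1; apply: sup_norm_ge => //.
by move/andP: x0l => [/ltW -> /ltW ->].
Qed.

Lemma bump_le1 x : `|g1 x| <= 1.
Proof.
apply: le1 bump_continuous1 bump_out1 _ x.
by rewrite -maxE !le_max lexx orbT.
Qed.

Lemma bump_le2 x : `|g2 x| <= 1.
Proof.
apply: le1 bump_continuous2 bump_out2 _ x.
by rewrite -maxE !le_max lexx !orbT.
Qed.

(** Otherwise g' = 0 everywhere, hence g = 0 and g'' = 0, against the normalization of the maximum
    to 1. *)
Lemma bump_neq0 : exists2 c, 0 < c < l & g1 c != 0.
Proof.
apply: contrapT => H.
have g10 x : g1 x = 0.
  have [x0l|/bump_out1 //] := boolP (0 < x < l).
  by apply/eqP/negPn/negP => g1x; apply: H; exists x.
have g0 x : g x = 0.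
  have [c _] := MVTr x 0 (fun x => bump_deriv x).
  by rewrite g10 mul0r (@bump_out 0) ?ltxx// sub0r => /eqP; rewrite oppr_eq0 => /eqP.
have g20 x : g2 x = 0.
  apply: (@has_deriv_near_cst g1 x 0); last exact: bump_deriv2.
  by near=> y; exact: g10.
have s0 (f : R -> R) : (forall x, f x = 0) -> sup_norm l f = 0.
  move=> f0; rewrite /sup_norm (_ : [set _ | _ in _] = [set 0]) ?sup1//.
  apply/seteqP; split => [_ [x _ <-]|_ ->]; first by rewrite f0 normr0.
  by exists 0; rewrite ?f0 ?normr0//= in_itv /= lexx (le_trans ler01 l1).
have := maxE; rewrite !s0// !maxxx => /eqP.
by rewrite eq_sym oner_eq0.
Unshelve. all: by end_near. Qed.

(** If [gtilde] vanished on ]0, l[, then g would be constant there, against [bump_neq0]. This makes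
    [c2] and [c3] positive. *)
Lemma bump_gtilde_norm2_gt0 : 0 < gtilde_norm2 l g.
Proof.
have [c c0l g1c] := bump_neq0.
have cgt : continuous (gtilde l g).
  by have cg := bump_continuous; rewrite /gtilde; cont.
have [c' c'0l gc'] : exists2 c, 0 < c < l & gtilde l g c != 0.
  apply: contrapT => H; move/eqP: g1c; apply.
  apply: (@has_deriv_near_cst g c (l^-1 * \int[mu]_(t in `[0, l]) g t));
    last exact: bump_deriv.
  have : nbhs c [set` `]0, l[] by apply: near_in_itvoo; rewrite in_itv.
  apply: filterS => y; rewrite /= in_itv /= => y0l.
  apply/eqP; rewrite -subr_eq0; apply/negPn/negP => gy.
  by apply: H; exists y.
have := Rintegral_sqr_gt0 cgt c'0l gc'.
have cg2 : continuous (fun x => gtilde l g x ^+ 2) by cont.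
rewrite /gtilde_norm2 -Rintegral_itv_obnd_cbnd; last first.
  apply: integrableS (continuous_integrable 0 l cg2) => //.
  exact: subset_itv_oc_cc.
rewrite -Rintegral_itv_bndo_bndc//.
apply: integrableS (continuous_integrable 0 l cg2) => //.
exact: subset_itv_oo_cc.
Qed.

(* [V] is a primitive of the effective one-dimensional potential of a unit bump;
   [t] is small enough for its mean [m / l] to be positive. *)
Lemma bump_potential : exists (t M m : R) (V v : R -> R),
  [/\ 0 <= t <= 1, 0 < m, (forall x, has_deriv V x (v x)), continuous v &
  [/\ (forall x, v x = 3 / 8 * t * g1 x ^+ 2 - t ^+ 2 * (g1 x ^+ 2 + g2 x ^+ 2)),
      (forall x, 0 <= x <= l -> `|V x| <= M), V 0 = 0 & V l = m]].
Proof.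
have cg1 := bump_continuous1; have cg2 := bump_continuous2.
have [c c0l g1c] := bump_neq0.
pose I1 := \int[mu]_(x in `[0, l]) g1 x ^+ 2.
pose I2 := \int[mu]_(x in `[0, l]) (g1 x ^+ 2 + g2 x ^+ 2).
have I10 : 0 < I1 by exact: Rintegral_sqr_gt0 cg1 c0l g1c.
have c1 : continuous (fun x => g1 x ^+ 2) by cont.
have c12 : continuous (fun x => g1 x ^+ 2 + g2 x ^+ 2) by cont.
have I12 : I1 <= I2.
  apply: le_Rintegral => //; [exact: continuous_integrable|exact: continuous_integrable|].
  by move=> x _; rewrite lerDl sqr_ge0.
have I20 : 0 < I2 by exact: lt_le_trans I12.
(* The maximizer of (3/8) t I1 - t^2 I2, with maximal value (3/16) t I1. *)
pose t := 3 / 16 * (I1 / I2).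
have q0 : 0 < I1 / I2 by exact: divr_gt0.
have q1 : I1 / I2 <= 1 by rewrite ler_pdivrMr// mul1r.
have t0 : 0 < t by rewrite /t; lra.
pose v x := 3 / 8 * t * g1 x ^+ 2 - t ^+ 2 * (g1 x ^+ 2 + g2 x ^+ 2).
have cv : continuous v by rewrite /v; cont.
have v_out x : ~~ (0 < x < l) -> v x = 0.
  by move=> x0; rewrite /v bump_out1// bump_out2// expr0n /= addr0 !mulr0 subrr.
have iv : mu.-integrable setT (EFin \o v).
  have := @integrable_restrict _ _ R mu `[0, l] (measurable_itv _) _ measurableT (EFin \o v).
  rewrite setTI => H; have := H.1 (continuous_integrable 0 l cv).
  congr (_ .-integrable _ _); apply/funext => x; rewrite patchE; case: ifPn => //.
  rewrite mem_setE in_itv /= => x0; rewrite /= v_out//.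
  by apply: contra x0 => /andP[/ltW -> /ltW ->].
(* Integrating from -oo gives a primitive on the whole line; it vanishes at 0 since [v] is supported
   in the cell. *)
pose V x := \int[mu]_(y in `]-oo, x]) v y.
have dV x : has_deriv V x (v x).
  have x1 : x < x + 1 by rewrite ltrDl.
  have iu : mu.-integrable [set` Interval -oo%O (BRight (x + 1))] (EFin \o v).
    exact: integrableS iv.
  have [d dE] := @continuous_FTC1 R v -oo%O x (x + 1) x1 iu (ltNyr _) (cv x).
  by split; [exact: d|rewrite -derive1E; exact: dE].
have V0 : V 0 = 0.
  rewrite /V (eq_Rintegral _ (g := fun=> 0)); last first.
    move=> x; rewrite inE /= in_itv /= => x0; apply: v_out.
    by rewrite negb_and -leNgt x0.
  by rewrite /Rintegral integral0.
have Vl : V l = 3 / 16 * t * I1.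
  have cV : {within `[0, l], continuous v} by exact: continuous_subspaceT.
  have l0 : 0 < l by lra.
  rewrite -[V l]subr0 -V0 -(Rintegral_derive l0 (fun x _ => dV x) cV) /v.
  have i1 : mu.-integrable `[0, l] (EFin \o fun x => 3 / 8 * t * g1 x ^+ 2).
    by apply: continuous_integrable; cont.
  have i2 : mu.-integrable `[0, l] (EFin \o fun x => t ^+ 2 * (g1 x ^+ 2 + g2 x ^+ 2)).
    by apply: continuous_integrable; cont.
  rewrite RintegralB// RintegralZl//; last exact: continuous_integrable.
  rewrite RintegralZl//; last exact: continuous_integrable.
  by rewrite -/I1 -/I2 /t; field; rewrite gt_eqF.
have cV : continuous V by move=> x; exact: has_deriv_cont (dV x).
have cn : {within `[0, l], continuous (fun x => `|V x|)}.
  apply: continuous_subspaceT => y.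
  by apply: (@continuous_comp _ _ _ V (fun y => `|y|)); [exact: cV|exact: norm_continuous].
have l0 : 0 <= l by lra.
have [d _ dP] := EVT_max l0 cn.
exists t, `|V d|, (3 / 16 * t * I1), V, v; split => //.
- by rewrite (ltW t0) /= /t; lra.
- by rewrite mulr_gt0//; lra.
Qed.

(** For x in the closed cell [k], a nonzero term of index i needs i l < x < (i + 1) l, which forces
    k - 1 < i < k + 1. *)
Lemma G_profile (w : Omega R) (N : nat) x : 0 < x < N%:R * l ->
  G l g w x = profile l g (fun k => (w k%:Z)%:num) N x.
Proof.
move=> /andP[x0 xN]; have l0 : 0 < l := lt_le_trans ltr01 l1.
have [k kN kx] : exists2 k, (k < N)%N & k%:R * l <= x <= k.+1%:R * l.
  elim: N xN => [|n IH] xN; first by move: (lt_trans x0 xN); rewrite mul0r ltxx.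
  have [xn|nx] := ltP x (n%:R * l); first by have [k kn kx] := IH xn; exists k => //; exact: ltnW.
  by exists n => //; rewrite nx ltW.
rewrite (@profile_cell R l g _ N l0 bump_out k x kN kx) /G.
rewrite -(@fsbig_widen _ _ _ _ [set k%:Z] [set: int])//; first by rewrite fsbig_set1.
move=> i [_ /= ik]; rewrite bump_out ?mulr0//; apply/negP => /andP[x1 x2].
move/andP: kx => [kx xk].
have : i%:~R * l < k.+1%:R * l by lra.
have : k%:R * l < (i%:~R + 1) * l by rewrite mulrDl mul1r; lra.
rewrite !ltr_pM2r// => h1 h2.
have k1 : (k%:Z < i + 1)%R by rewrite -(ltr_int R) intrD; exact: h1.
have k2 : (i < k.+1%:Z)%R by rewrite -(ltr_int R); exact: h2.
by apply: ik; move: k1 k2; clear; lia.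
Qed.

End Bump.

(** * The potential along the guide and the bound for a fixed configuration *)

Section Deterministic.
Context {R : realType}.

(* Walking through windows of length [n] that each contain a site marked by [e],
   a potential gaining [A] at marked sites and paying [A / (2 n)] everywhere stays
   bounded when it is reset to its initial value at the end of every window. *)
Lemma bounded_potential (A : R) (n : nat) : 0 <= A -> (0 < n)%N ->
  forall (N : nat) (e : nat -> bool), (n <= N)%N ->
  (forall s, (s * n + n <= N)%N -> exists2 j, (s * n <= j < s * n + n)%N & e j) ->
  exists al : nat -> R, [/\ forall k, (k <= N)%N -> `|al k| <= A, al 0%N <= 0,
    0 <= al N & forall k, (k < N)%N ->
      al k.+1 <= al k + (if e k then A else 0) - A / (2 * n%:R)].
Proof.
move=> A0 n0; have n0R : 0 < n%:R :> R by rewrite ltr0n.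
pose c : R := A / (2 * n%:R).
have c0 : 0 <= c by rewrite divr_ge0// mulr_ge0.
have cn : c * (2 * n%:R) = A by rewrite /c mulfVK// gt_eqF// mulr_gt0.
pose q (e : nat -> bool) k := has e (iota 0 k).
have qS e k : q e k.+1 = q e k || e k.
  by rewrite /q -addn1 iotaD has_cat /= orbF add0n.
(* [q e k] records a marked site before [k], so [A] is gained once, at the first marked site. This
   keeps the walk within [-A, A] for up to 2 n steps, as 2 n c = A. *)
pose walk e k : R := (if q e k then A else 0) - c * k%:R.
have walk0 e : walk e 0%N = 0 by rewrite /walk /= mulr0 subr0.
have walkS e k : walk e k.+1 <= walk e k + (if e k then A else 0) - c.
  rewrite /walk qS -natr1 mulrDr mulr1.
  by case: (q e k); case: (e k) => /=; lra.
have walk_le e k : (k < 2 * n)%N -> `|walk e k| <= A.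
  move=> kn; have kR : k%:R <= 2 * n%:R :> R by rewrite -natrM ler_nat ltnW.
  have h0 : 0 <= c * k%:R by rewrite mulr_ge0.
  have h1 : c * k%:R <= A by rewrite -cn ler_wpM2l.
  by rewrite /walk ler_norml; case: (q e k); apply/andP; split; lra.
have walk_end (e : nat -> bool) k j : (j < k)%N -> e j -> (k <= 2 * n)%N -> 0 <= walk e k.
  move=> jk ej kn; have -> : walk e k = A - c * k%:R.
    by rewrite /walk /q; case: hasP => // -[]; exists j => //; rewrite mem_iota add0n.
  by rewrite subr_ge0 -cn ler_wpM2l// -natrM ler_nat.
elim/ltn_ind => N IH e nN He.
have [j jn ej] : exists2 j, (j < n)%N & e j.
  by have [|j] := He 0%N; [rewrite mul0n|rewrite mul0n add0n => /= jn ej; exists j].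
(* A remainder shorter than [n] is joined to the last window, whose length is then below 2 n; this
   is the origin of the 2 in A / (2 n). *)
have [N2n|N2n] := ltnP N (2 * n).
  exists (fun k => if (k < N)%N then walk e k else 0); split.
  - move=> k _; case: ifP => [kN|_]; last by rewrite normr0.
    by apply: walk_le; exact: ltn_trans N2n.
  - by case: ifP; rewrite ?walk0.
  - by rewrite ltnn.
  - move=> k kN; rewrite kN; case: ifPn => [_|]; first exact: walkS.
    rewrite -leqNgt => Nk; apply: le_trans (walkS e k).
    apply: (@walk_end _ _ j) => //; first exact: leq_trans jn (leq_trans nN Nk).
    by rewrite (leq_trans kN)// ltnW.
have [|||al [al_le al0 alN alS]] := IH (N - n)%N _ (fun k => e (n + k)%N).
- by rewrite ltn_subrL n0 (leq_trans n0).
- by rewrite leq_subRL// addnn -mul2n.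
- move=> s sN; have [|i] := He s.+1.
    by rewrite mulSn -addnA addnC -leq_subRL// addnC; lia.
  rewrite mulSn => /andP[i1 i2] ei; exists (i - n)%N; first by lia.
  by rewrite subnKC//; lia.
(* At k = n the walk is nonnegative, thanks to the marked site, and drops to the initial value
   [al 0] <= 0 of the rest. *)
exists (fun k => if (k < n)%N then walk e k else al (k - n)%N); split.
- move=> k kN; case: ifPn => [kn|]; first by apply: walk_le; lia.
  by move=> ?; apply: al_le; lia.
- by rewrite n0 walk0.
- by rewrite ltnNge nN.
- move=> k kN; have [kn|nk] := ltnP k n.
    case: ifPn => [_|]; first exact: walkS.
    rewrite -leqNgt => nk; have -> : (k.+1 - n = 0)%N by lia.
    apply: le_trans al0 _; apply: le_trans (walkS e k).
    by apply: (@walk_end _ _ j) => //; lia.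
  rewrite ltnNge (leq_trans nk)//= subSn//.
  have := alS (k - n)%N; rewrite subnKC//; apply.
  by lia.
Qed.

(** Configurations take arbitrary nonnegative values, so the bound by 1 on the sites 0, ..., N - 1
    is a hypothesis; it is supplied later outside a null event. *)
Lemma lambda_ge (l : R) (g : R -> R) (t M m kap A dl : R) (V v : R -> R)
    (w : Omega R) (N : nat) (al : nat -> R) : 1 <= l -> is_bump l g ->
  0 <= t <= 1 -> (forall x, has_deriv V x (v x)) -> continuous v ->
  (forall x, v x = 3 / 8 * t * derive1 g x ^+ 2 -
     t ^+ 2 * (derive1 g x ^+ 2 + derive1 (derive1 g) x ^+ 2)) ->
  (forall x, 0 <= x <= l -> `|V x| <= M) -> V 0 = 0 -> V l = m ->
  0 <= kap <= 1 -> 0 <= dl ->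
  (forall k, (k < N)%N -> (w k%:Z)%:num <= 1) ->
  (forall k, (k <= N)%N -> `|al k| <= A) -> al 0%N <= 0 -> 0 <= al N ->
  (forall k, (k < N)%N -> al k.+1 <= al k + (w k%:Z)%:num ^+ 2 * m - dl * l) ->
  0 <= 1 + kap ^+ 2 * dl - kap ^+ 3 * (1 + (A + M + dl * l)) ^+ 2 ->
  ((1 + kap ^+ 2 * dl - kap ^+ 3 * (1 + (A + M + dl * l)) ^+ 2)%:E <=
    lambda l g kap w N)%E.
Proof.
move=> l1 bump t01 dV cv vE V_leM V0 Vl kap01 dl0 w1 al_leA al0 alN al_step E0.
have l0 : 0 < l := lt_le_trans ltr01 l1.
pose w' k := (w k%:Z)%:num.
have cg := bump_continuous bump.
have DE : segment l g kap w N = [set x | 0 < x.1 < N%:R * l /\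
    kap * profile l g w' N x.1 < x.2 < kap * profile l g w' N x.1 + pi].
  apply/seteqP; split => x [x1 x2]; split => //; move: x2; rewrite (G_profile l1 bump _ x1) //.
have GE : forall x, dirichlet_boundary l g kap w N x <-> (0 < x.1 < N%:R * l /\
    (x.2 = kap * profile l g w' N x.1 \/ x.2 = kap * profile l g w' N x.1 + pi)).
  by move=> x; split=> -[x1 x2]; split => //; move: x2; rewrite (G_profile l1 bump _ x1).
have mD : measurable (segment l g kap w N).
  by rewrite DE; apply: open_measurable2; exact: open_domain.
apply: lowest_eigenvalue_ge => // phi phi1 phi0.
have [_ _ cd1 cd2] := phi1.
have md (f : R * R -> R) : continuous f ->
    measurable_fun (segment l g kap w N) (fun x => (f x ^+ 2)%:E).
  move=> cf; apply: measurable_fun_sqr => //; apply: measurable_funTS.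
  exact: continuous_measurable_fun2.
have -> : (energy (segment l g kap w N) (d1 phi) + energy (segment l g kap w N) (d2 phi) =
   \int[@lebesgue_measure R \x @lebesgue_measure R]_(x in segment l g kap w N)
     (d1 phi x ^+ 2 + d2 phi x ^+ 2)%:E)%E.
  rewrite /energy -ge0_integralD//.
  - by move=> x _; rewrite lee_fin sqr_ge0.
  - exact: md.
  - by move=> x _; rewrite lee_fin sqr_ge0.
  - exact: md.
rewrite /energy DE.
apply: (@domain_energy R l kap g w' N l0 cg (bump_out bump) _ _ V v t M m dl A al
  (bump_deriv bump) (bump_deriv2 bump)) => //.
- exact: (bump_continuous2 bump).
- exact: (bump_out1 bump).
- exact: (bump_le1 bump).
- exact: (bump_le2 bump).
- by move=> k kN; rewrite /w' w1// andbT.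
- by move=> x x1 x2; apply: phi0; apply/GE.
Qed.

End Deterministic.

(** * Random configurations *)

Section Probability.
Context {R : realType}.
Context (mu : probability (measurableTypeR R) R).
Context (mu_support : mu `[0, 1]%classic = 1%E) (mu_nontrivial : mu [set 0] <> 1%E).

Lemma mu_null (A : set R) : measurable A -> A `&` `[0, 1]%classic = set0 -> mu A = 0%E.
Proof.
move=> mA A01; have h := probability_setC mu (measurable_itv `[0, 1]).
have h0 : mu (~` `[0, 1]%classic) = 0%E by rewrite h [X in (_ - X)%E]mu_support subee.
apply/eqP; rewrite -measure_le0 -h0; apply: le_measure; rewrite ?inE//.
  by apply: measurableC; exact: measurable_itv.
by move=> x Ax x01; have : (A `&` `[0, 1]%classic) x by []; rewrite A01.
Qed.

Lemma mu_gt1 : mu `]1, +oo[%classic = 0%E.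
Proof.
apply: mu_null => //; apply/seteqP; split => x //= [].
by rewrite !in_itv /= andbT => x1 /andP[_]; rewrite leNgt x1.
Qed.

(** Otherwise ]0, +oo[ would be a countable union of the null sets [1 / (k + 1), +oo[, and all mass
    would sit at 0. *)
Lemma mu_below_lt1 : exists2 e : R, 0 < e & (mu `]-oo, e[%classic < 1)%E.
Proof.
apply: contrapT => H; apply: mu_nontrivial.
have e1 (e : R) : 0 < e -> mu `[e, +oo[%classic = 0%E.
  move=> e0; have he : mu `]-oo, e[%classic = 1%E.
    apply/eqP; rewrite eq_le probability_le1//= leNgt; apply/negP => e1.
    by apply: H; exists e.
  have := probability_setC mu (measurable_itv `]-oo, e[).
  by rewrite [X in (_ - X)%E]he subee// setCitvl.
have pos0 : mu `]0, +oo[%classic = 0%E.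
  have -> : `]0, +oo[%classic = \bigcup_k `[k.+1%:R^-1, +oo[%classic :> set R.
    apply/seteqP; split => [x|x [k _]] /=; rewrite !in_itv /= !andbT.
      move=> x0; exists (Num.truncn x^-1) => //=; rewrite in_itv /= andbT.
      rewrite -[leRHS]invrK lef_pV2 ?posrE ?invr_gt0//.
      by apply/ltW; exact: truncnS_gt.
    by apply: lt_le_trans; rewrite invr_gt0.
  pose F (k : nat) : set R := `[k.+1%:R^-1, +oo[%classic.
  have mF k : measurable (F k) by exact: measurable_itv.
  apply/eqP; rewrite -measure_le0.
  have := measure_sigma_subadditive mu mF (bigcupT_measurable F mF) (@subset_refl _ _).
  move=> /le_trans; apply.
  by rewrite eseries0// => k _ _; apply: e1; rewrite invr_gt0.
apply/eqP; rewrite eq_le probability_le1//= -[leLHS]mu_support.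
have -> : mu [set 0] = (mu [set 0%R] + mu `]0%R, +oo[%classic)%E by rewrite [X in (_ + X)%E]pos0 adde0.
apply: le_trans (measureU2 _ _ _); try exact: measurable_itv; try exact: measurable_set1.
apply: le_measure; rewrite ?inE; first exact: measurable_itv.
  by apply: measurableU; [exact: measurable_set1|exact: measurable_itv].
move=> x /=; rewrite !in_itv /= andbT le_eqVlt => /andP[/predU1P[<-|x0] _]; [by left|by right].
Qed.

Lemma mean_gt0 : 0 < mean mu.
Proof.
have [e e0 he] := mu_below_lt1.
have e_pos : (0 < mu `[e, 1%R]%classic)%E.
  rewrite lt_neqAle measure_ge0 andbT eq_sym; apply/eqP => e10.
  move: he; rewrite ltNge => /negP; apply.
  rewrite -[leLHS]mu_support.
  have -> : mu `]-oo, e[%classic = (mu `]-oo, e[%classic + mu `[e, 1%R]%classic)%E by rewrite [X in (_ + X)%E]e10 adde0.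
  apply: le_trans (measureU2 _ _ _); try exact: measurable_itv.
  apply: le_measure; rewrite ?inE; [exact: measurable_itv|by apply: measurableU; exact: measurable_itv|].
  move=> x /=; rewrite !in_itv /= => /andP[x0 x1].
  by have [ex|xe] := leP e x; [right; apply/andP|left].
pose f (x : R) : \bar R := x%:E.
have mf (A : set R) : measurable_fun A f.
  by apply: measurable_funTS; apply/measurable_EFinP; exact: measurable_id.
have m01 : measurable `[0 : R, 1]%classic by exact: measurable_itv.
have E : (\int[mu]_x f x = \int[mu]_(x in `[0%R, 1%R]) f x)%E.
  rewrite [RHS]integral_mkcond; apply: ae_eq_integral => //.
    exact: mf.
    by apply/(measurable_restrictT _ m01); exact: mf.
  exists (~` `[0, 1]%classic); split; first exact: measurableC.
    apply: mu_null; first exact: measurableC.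
    by rewrite setICl.
  move=> x /= H x01; apply: H => _; rewrite patchE.
  by rewrite mem_setE x01.
have f0 (x : R) : `[0, 1]%classic x -> (0 <= f x)%E.
  by rewrite /= in_itv /= lee_fin => /andP[].
rewrite /mean /Rintegral E; apply: fine_gt0; apply/andP; split.
  apply: (@lt_le_trans _ _ (\int[mu]_(x in `[e, 1%R]) e%:E)%E).
    rewrite integral_cst; last exact: measurable_itv.
    by rewrite mule_gt0.
  apply: (@le_trans _ _ (\int[mu]_(x in `[e, 1%R]) f x)%E).
    apply: ge0_le_integral => //; try exact: measurable_itv.
    - by move=> x _; rewrite lee_fin ltW.
    - exact: mf.
    - by move=> x /=; rewrite in_itv /= => /andP[ex _]; rewrite lee_fin.
  apply: ge0_subset_integral => //; try exact: measurable_itv; try exact: mf.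
  move=> x /=; rewrite !in_itv /= => /andP[ex ->]; rewrite andbT.
  by apply: le_trans ex; exact: ltW.
(* Finiteness matters for positivity too, since [fine] sends +oo to 0. *)
apply: (@le_lt_trans _ _ (\int[mu]_(x in `[0%R, 1%R]) 1%:E)%E).
  apply: ge0_le_integral => //; try exact: mf.
  by move=> x /=; rewrite in_itv /= lee_fin => /andP[].
by rewrite integral_cst// mul1e [X in (X < _)%E]mu_support ltry.
Qed.

Context (P : probability (Omega R) R) (iid : iid_law mu P).

Definition coord (j : nat) (w : Omega R) : R := (w j%:Z)%:num.

Lemma measurable_cylinder (B : int -> set R) (s : seq int) :
  (forall k, measurable (B k)) ->
  measurable ([set w : int -> {nonneg R} | forall k, k \in s -> B k (w k)%:num] : set (Omega R)).
Proof.
move=> mB; have -> : [set w : int -> {nonneg R} | forall k, k \in s -> B k (w k)%:num] =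
    \bigcap_(k in [set` s]) ((fun w : int -> {nonneg R} => (w k)%:num) @^-1` B k).
  by apply/seteqP; split => w H k; exact: H.
apply: fin_bigcap_measurable => [|k _]; first exact: finite_seq.
by apply: sub_sigma_algebra; exists k, (B k).
Qed.

Lemma P_block (B : set R) (a n : nat) : measurable B ->
  measurable ([set w | forall j, (a <= j < a + n)%N -> B (coord j w)] : set (Omega R)) /\
  P [set w | forall j, (a <= j < a + n)%N -> B (coord j w)] = (mu B ^+ n)%E.
Proof.
move=> mB; pose s : seq int := map Posz (iota a n).
have E : [set w : Omega R | forall j, (a <= j < a + n)%N -> B (coord j w)] =
    [set w : int -> {nonneg R} | forall k, k \in s -> (fun=> B) k (w k)%:num].
  apply/seteqP; split => w H.
    by move=> k /mapP[j]; rewrite mem_iota => jn ->; exact: H.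
  move=> j jn; apply: (H j%:Z); apply/mapP; exists j => //.
  by rewrite mem_iota.
rewrite E; split; first exact: (@measurable_cylinder (fun=> B) s (fun=> mB)).
have us : uniq s by rewrite map_inj_uniq ?iota_uniq// => x y [].
rewrite (iid us (fun=> mB)).
by rewrite big_map big_const_seq count_predT size_iota iter_mule mule1.
Qed.

(** Bad means that one of the N %/ n disjoint full windows has all its sites below [e], or that one
    of the first N sites exceeds 1. The former is a union bound with independence inside each
    window; the latter is null. *)
Lemma P_bad_le (e : R) (N n : nat) (q : R) : (mu `]-oo, e[%classic <= q%:E)%E -> (0 < n)%N ->
  exists bad : set (Omega R), [/\ measurable bad,
    (P bad <= ((N %/ n)%:R * q ^+ n)%:E)%E &
    forall w, ~ bad w ->
      (forall k, (k < N)%N -> coord k w <= 1) /\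
      (forall s, (s * n + n <= N)%N ->
         exists2 j, (s * n <= j < s * n + n)%N & e <= coord j w)].
Proof.
move=> muq n0.
pose bad1 s := [set w : Omega R | forall j, (s * n <= j < s * n + n)%N -> `]-oo, e[%classic (coord j w)].
pose bad2 k := [set w : Omega R | forall j, (k <= j < k + 1)%N -> `]1, +oo[%classic (coord j w)].
have h1 s := P_block (s * n) n (measurable_itv `]-oo, e[).
have h2 k := P_block k 1 (measurable_itv `]1, +oo[).
have m1 : measurable (\big[setU/set0]_(s < N %/ n) bad1 s).
  by apply: bigsetU_measurable => s _; exact: (h1 s).1.
have m2 : measurable (\big[setU/set0]_(k < N) bad2 k).
  by apply: bigsetU_measurable => k _; exact: (h2 k).1.
exists (\big[setU/set0]_(s < N %/ n) bad1 s `|` \big[setU/set0]_(k < N) bad2 k).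
split; first exact: measurableU.
- apply: le_trans (measureU2 _ m1 m2) _.
  have q0 : 0 <= q by rewrite -lee_fin; exact: le_trans muq.
  have P1 : (P (\big[setU/set0]_(s < N %/ n) bad1 s) <= ((N %/ n)%:R * q ^+ n)%:E)%E.
    apply: le_trans (content_subadditive P (fun s _ => (h1 s).1) m1 (@subset_refl _ _)) _.
    apply: (@le_trans _ _ (\sum_(s < N %/ n) (q ^+ n)%:E)%E).
      apply: lee_sum => s _; apply: (@le_trans _ _ (mu `]-oo, e[%classic ^+ n)%E).
        by rewrite -(h1 s).2.
      rewrite EFin_expe; elim: n {n0 bad1 h1 m1 s} => [|n IH]; first by rewrite !expe0.
      by rewrite !expeS lee_pmul// expe_ge0.
    by rewrite sumEFin sumr_const card_ord mulr_natl.
  have P2 : (P (\big[setU/set0]_(k < N) bad2 k) <= 0)%E.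
    apply: le_trans (content_subadditive P (fun k _ => (h2 k).1) m2 (@subset_refl _ _)) _.
    rewrite big1// => k _; etransitivity; first exact: (h2 k).2.
    exact: mu_gt1.
  by apply: le_trans (leeD P1 P2) _; rewrite adde0.
- move=> w nbad; split => [k kN|s sN].
    rewrite leNgt; apply/negP => k1; apply: nbad; right.
    rewrite -bigcup_mkord; exists k => //= j; rewrite addn1 ltnS => jk.
    have -> : j = k by apply/eqP; rewrite eqn_leq andbC.
    by rewrite /= in_itv /= k1.
  apply: contrapT => H; apply: nbad; left.
  rewrite -bigcup_mkord; exists s => /=.
    by rewrite leq_divRL// mulSn addnC.
  move=> j jn /=; rewrite in_itv /= ltNge; apply/negP => ej.
  by apply: H; exists j.
Qed.

End Probability.

(** * Comparison of powers of N *)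

Section Scales.
Context {R : realType}.

Lemma powR_large (a b : R) : 0 < a ->
  exists N1 : nat, forall N, (N1 <= N)%N -> b <= N%:R `^ a.
Proof.
move=> a0; pose B := Num.max b 1.
have B0 : 0 < B by rewrite lt_max ltr01 orbT.
exists (Num.truncn (B `^ a^-1)).+1 => N BN.
apply: (@le_trans _ _ B); first by rewrite le_max lexx.
have -> : B = (B `^ a^-1) `^ a by rewrite -powRrM mulVf ?gt_eqF// powRr1// ltW.
apply: ge0_ler_powR; rewrite ?nnegrE ?powR_ge0 ?(ltW a0)//.
apply: (@le_trans _ _ (Num.truncn (B `^ a^-1)).+1%:R); last by rewrite ler_nat.
by apply/ltW; exact: truncnS_gt.
Qed.

(** Half of the gain kap^2 A / (2 n l) absorbs the cubic error, by kap X^2 <= C3 and large X. The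
    other half is at least (Ca X r)^2 A / (8 l X), which exceeds r^2 by a factor of order X. *)
Lemma scale_bound (X n kap r Ca C3 A M l : R) : 1 <= X -> 0 < n -> 1 <= n -> n <= 2 * X ->
  0 < A -> 0 <= M -> 0 < l -> 0 < r -> 0 < Ca -> 0 < C3 ->
  Ca * X * r <= kap -> kap * X ^+ 2 <= C3 ->
  8 * l * C3 * (1 + (A + M + A)) ^+ 2 <= A * X -> 8 * l < Ca ^+ 2 * A * X ->
  r ^+ 2 < kap ^+ 2 * (A / (2 * n * l)) -
    kap ^+ 3 * (1 + (A + M + A / (2 * n * l) * l)) ^+ 2.
Proof.
move=> X1 n0 n1 nX A0 M0 l0 r0 Ca0 C30 kap_ge kap_le big1 big2.
have X0 : 0 < X by exact: lt_le_trans X1.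
pose dl := A / (2 * n * l); rewrite -/dl.
have dl0 : 0 < dl by rewrite divr_gt0// !mulr_gt0.
have dll : dl * l = A / (2 * n) by rewrite /dl; field; rewrite !gt_eqF.
have dlA : dl * l <= A.
  by rewrite dll ler_pdivrMr ?mulr_gt0// ler_peMr ?(ltW A0)//; lra.
have dll0 : 0 <= dl * l by rewrite mulr_ge0// ltW.
have dlX : A / (8 * l * X) <= dl / 2.
  have -> : dl / 2 = A / (4 * n * l) by rewrite /dl; field; rewrite !gt_eqF.
  rewrite ler_pM2l// lef_pV2 ?posrE ?mulr_gt0//.
  have -> : 8 * l * X = 4 * (2 * X) * l by ring.
  by rewrite ler_pM2r// ler_pM2l.
pose Q := (1 + (A + M + A)) ^+ 2.
have Q0 : 0 <= Q by exact: sqr_ge0.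
have QQ : (1 + (A + M + dl * l)) ^+ 2 <= Q.
  by rewrite /Q ler_sqr ?nnegrE; lra.
have kap0 : 0 < kap by apply: lt_le_trans kap_ge; rewrite !mulr_gt0.
have kQ : kap * Q <= A / (8 * l * X).
  rewrite ler_pdivlMr ?mulr_gt0// -(ler_pM2r X0); apply: le_trans big1.
  have -> : kap * Q * (8 * l * X) * X = 8 * l * Q * (kap * X ^+ 2) by ring.
  have -> : 8 * l * C3 * (1 + (A + M + A)) ^+ 2 = 8 * l * Q * C3 by rewrite /Q; ring.
  by apply: ler_wpM2l => //; apply: mulr_ge0 => //; apply: mulr_ge0; last exact: ltW.
have kQ2 : kap * (1 + (A + M + dl * l)) ^+ 2 <= dl / 2.
  apply: le_trans dlX; apply: le_trans kQ.
  by rewrite ler_wpM2l// ltW.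
have k2 : (Ca * X * r) ^+ 2 <= kap ^+ 2.
  by rewrite ler_sqr ?nnegrE ?(ltW kap0)// !mulr_ge0// ltW.
apply: (@lt_le_trans _ _ (kap ^+ 2 * (dl / 2))); last first.
  have -> : kap ^+ 3 * (1 + (A + M + dl * l)) ^+ 2 =
    kap ^+ 2 * (kap * (1 + (A + M + dl * l)) ^+ 2) by ring.
  have := ler_wpM2l (sqr_ge0 kap) kQ2.
  by lra.
apply: (@lt_le_trans _ _ ((Ca * X * r) ^+ 2 * (A / (8 * l * X)))); last first.
  by rewrite ler_pM ?sqr_ge0// divr_ge0 ?(ltW A0)// !mulr_ge0// ltW.
have -> : (Ca * X * r) ^+ 2 * (A / (8 * l * X)) = r ^+ 2 * ((Ca ^+ 2 * A * X) / (8 * l)).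
  by field; rewrite !gt_eqF.
by rewrite ltr_pMr ?exprn_gt0// ltr_pdivlMr ?mulr_gt0// mul1r.
Qed.

End Scales.

Theorem theorem3p1 (R : realType) (mu : probability (measurableTypeR R) R)
    (mu_support : mu `[0, 1]%classic = 1%E) (mu_nontrivial : mu [set 0] <> 1%E) :
  exists2 c4 : R, 0 < c4 &
    forall (P : probability (Omega R) R) (l : R) (g : R -> R) (gamma : R),
      iid_law mu P -> 1 <= l -> is_bump l g -> 34 < gamma ->
      exists N1 : nat, forall N : nat, (N1 <= N)%N ->
        kappa_interval l g mu gamma N !=set0 /\
        forall kappa : R, kappa_interval l g mu gamma N kappa ->
          (P^*%mu [set w | lambda l g kappa w N - 1 <=
                             (N%:R `^ (- 2^-1))%:E] <=
           (N%:R `^ (1 - gamma^-1) * expR (- c4 * N%:R `^ gamma^-1))%:E)%E.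
Proof.
have [e e0 he] := mu_below_lt1 mu_support mu_nontrivial.
have mean0 := mean_gt0 mu_support mu_nontrivial.
(* The value 2^-1 keeps [q] positive, hence ln q < 0, even if [mu] has no mass below [e]. Both [e]
   and [q] are fixed before [l], [g] and [gamma]. *)
pose q := Num.max 2^-1 (fine (mu `]-oo, e[%classic)).
have muE : mu `]-oo, e[%classic = (fine (mu `]-oo, e[%classic))%:E.
  by rewrite fineK// fin_num_measure.
have q0 : 0 < q by rewrite lt_max invr_gt0 ltr0n.
have q1 : q < 1.
  by rewrite gt_max -(lte_fin (fine _)) -muE he andbT; lra.
have muq : (mu `]-oo, e[%classic <= q%:E)%E by rewrite muE lee_fin le_max lexx orbT.
have c40 : 0 < - ln q by rewrite oppr_gt0 ln_lt0// q0.
exists (- ln q) => // P l g gamma iid l1 bump gamma34.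
have [t [M [m [V [v [t01 m0 dV cv [vE V_leM V0 Vl]]]]]]] := bump_potential l1 bump.
have l0 : 0 < l := lt_le_trans ltr01 l1.
rewrite /kappa_interval.
have [] : 0 < c2 l g /\ 0 < c3 l g.
  have pos a b : 0 < 3 * gtilde_norm2 l g / (a.+1%:R * l ^+ b).
    apply: divr_gt0; last by apply: mulr_gt0; [rewrite ltr0n|exact: exprn_gt0].
    by apply: mulr_gt0; [rewrite ltr0n|exact: bump_gtilde_norm2_gt0].
  by split; exact: pos.
(* The values of these constants play no role, only their positivity does. *)
move: (c2 l g) (c3 l g) (mean mu) mean0 => C2 C3 Ew Ew0 C20 C30.
pose Ca := 2 / (Ew * Num.sqrt C2).
have Ca0 : 0 < Ca by rewrite divr_gt0// mulr_gt0// sqrtr_gt0.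
pose A := e ^+ 2 * m.
have A0 : 0 < A by rewrite mulr_gt0// exprn_gt0.
have M0 : 0 <= M by have := V_leM 0; rewrite V0 normr0; apply; rewrite lexx ltW.
have gamma0 : 0 < gamma by lra.
have gi0 : 0 < gamma^-1 by rewrite invr_gt0.
have gi34 : gamma^-1 < 34^-1 by rewrite ltf_pV2 ?posrE//; lra.
(* Up to constants, N^beta is the ratio of the two ends of the interval: -15 / (2 gamma) - (1 /
   gamma - 1/4). It is positive exactly for gamma > 34. *)
pose beta := 4^-1 - 17 / 2 * gamma^-1.
have beta0 : 0 < beta by rewrite /beta; lra.
(* Thresholds for X = N^(1/gamma): X >= 1, kappa <= 1, gain above the cubic error, and gain above
   r^2, where + 1 makes the last one strict. *)
pose big := Num.max (Num.max 1 (C3))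
  (Num.max (8 * l * C3 * (1 + (A + M + A)) ^+ 2 / A) (8 * l / (Ca ^+ 2 * A) + 1)).
have [Na HNa] := powR_large big gi0.
have [Nb HNb] := powR_large (Ca / C3) beta0.
(* N >= 4 gives sqrt N >= 2, hence X + 1 <= sqrt N + 1 <= N, and a whole window fits. *)
exists (maxn 4 (maxn Na Nb)) => N; rewrite !geq_max => /and3P[N4 /HNa HX /HNb HB].
have N0 : 0 < N%:R :> R by rewrite ltr0n (leq_trans _ N4).
have N1 : 1 <= N%:R :> R by rewrite ler1n (leq_trans _ N4).
pose X := N%:R `^ gamma^-1 : R; rewrite -/X in HX.
have powD (a b : R) : N%:R `^ (a + b) = N%:R `^ a * N%:R `^ b :> R.
  by rewrite powRD// (gt_eqF N0) implybT.
pose r := N%:R `^ (- 4^-1) : R.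
have r0 : 0 < r by exact: powR_gt0.
have r2 : N%:R `^ (- 2^-1) = r ^+ 2 :> R.
  by rewrite expr2 /r -powD; congr (_ `^ _); lra.
move: HX; rewrite /big !ge_max => /andP[/andP[X1 Xc3] /andP[XA XCa]].
have X0 : 0 < X by exact: lt_le_trans X1.
have loE : 2 * N%:R `^ (gamma^-1 - 4^-1) / (Ew * Num.sqrt (C2)) = Ca * X * r.
  by rewrite powD -/X -/r /Ca; ring.
clearbody Ca.
have CXr0 : 0 < Ca * X * r by rewrite !mulr_gt0.
have hiE : N%:R `^ (- (15 / (2 * gamma))) = N%:R `^ beta * (X * r) :> R.
  rewrite /X /r -!powD; congr (_ `^ _); rewrite /beta; field.
  by rewrite gt_eqF.
split.
  exists (Ca * X * r); rewrite /= in_itv /= loE lexx /= hiE.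
  rewrite mulrA -mulrA ler_wpM2r//; first by rewrite mulr_ge0// ltW.
  by rewrite mulrC -ler_pdivrMr.
move=> kappa; rewrite /= in_itv /= loE => /andP[kap_ge kap_le].
have kap0 : 0 < kappa by exact: lt_le_trans kap_ge.
(* In units of 1 / gamma the exponent is -15/2 + 2 = -11/2 < 0. *)
have kapX : kappa * X ^+ 2 <= C3.
  apply: le_trans (ler_wpM2r (sqr_ge0 X) kap_le) _.
  rewrite -mulrA ler_piMr ?(ltW C30)// expr2 /X -!powD.
  rewrite -[leRHS](powRr0 N%:R); apply: ler_powR => //.
  have -> : - (15 / (2 * gamma)) + (gamma^-1 + gamma^-1) = - (11 / 2 * gamma^-1).
    by field; rewrite gt_eqF.
  by rewrite oppr_le0 mulr_ge0// ltW.
have kap1 : kappa <= 1.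
  rewrite -(ler_pM2r X0) mul1r; apply: le_trans Xc3; apply: le_trans kapX.
  by rewrite ler_pM2l// expr2 ler_peMr// ltW.
(* X < n makes q^n at most q^X and N %/ n at most N / X = N^(1 - 1/gamma), while n <= X + 1 <= 2 X
   keeps the gain of order 1 / X. *)
pose n := (Num.truncn X).+1.
have nX : X < n%:R by exact: truncnS_gt.
have n0 : (0 < n)%N by [].
have nX1 : n%:R <= X + 1.
  by rewrite -natr1 lerD2r truncn_le ltW.
have nN : (n <= N)%N.
  pose s := N%:R `^ (2^-1) : R.
  have ss : s * s = N%:R by rewrite /s -powD -[RHS]powRr1 ?ltW//; congr (_ `^ _); lra.
  have s0 : 0 <= s by exact: powR_ge0.
  have Xs : X <= s by apply: ler_powR => //; lra.
  have s2 : 2 <= s.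
    rewrite -(ler_pM2l (_ : 0 < 2))// -ler_sqr ?nnegrE ?mulr_ge0//.
    have -> : (2 * s) ^+ 2 = 4 * (s * s) by ring.
    have : 4%:R <= N%:R :> R by rewrite ler_nat.
    by rewrite ss; lra.
  rewrite -(ler_nat R); apply: le_trans nX1 _; rewrite -ss.
  by nra.
have n1 : 1 <= n%:R :> R by rewrite ler1n.
have n0R : 0 < n%:R :> R by rewrite ltr0n.
pose dl := A / (2 * n%:R * l).
have dl0 : 0 <= dl by rewrite divr_ge0 ?(ltW A0)// !mulr_ge0// ltW.
have dll : dl * l = A / (2 * n%:R) by rewrite /dl; field; rewrite !gt_eqF.
pose E := 1 + kappa ^+ 2 * dl - kappa ^+ 3 * (1 + (A + M + dl * l)) ^+ 2.
have Er : r ^+ 2 < E - 1.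
  have -> : E - 1 = kappa ^+ 2 * dl - kappa ^+ 3 * (1 + (A + M + dl * l)) ^+ 2.
    by rewrite /E; ring.
  apply: (@scale_bound _ X n%:R kappa r Ca (C3) A M l) => //.
  - by apply: le_trans nX1 _; lra.
  - by rewrite [leRHS]mulrC -ler_pdivrMr.
  - rewrite [ltRHS]mulrC -ltr_pdivrMr ?mulr_gt0 ?exprn_gt0//.
    by apply: lt_le_trans XCa; rewrite ltrDl.
have E0 : 0 <= E by have := sqr_ge0 r; lra.
have [bad [mbad Pbad good]] := P_bad_le mu_support iid N muq n0.
have sub : [set w | (lambda l g kappa w N - 1 <= (N%:R `^ (- 2^-1))%:E)%E] `<=` bad.
  move=> w /= lw; apply: contrapT => nbad.
  have [w1 wn] := good w nbad.
  have [al [al_le al0 alN alS]] := bounded_potential (ltW A0) n0 nN wn.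
  have : (E%:E <= lambda l g kappa w N)%E.
    apply: (@lambda_ge R l g t M m kappa A dl V v w N al) => //.
    - by rewrite (ltW kap0).
    - move=> k kN; apply: le_trans (alS k kN) _; rewrite dll lerD2r lerD2l.
      case: ifPn => [ek|_]; last by rewrite mulr_ge0 ?sqr_ge0// ltW.
      by rewrite /A ler_pM2r// ler_sqr ?nnegrE// ltW.
  move=> /(leeD2r (- 1%:E)%E) /le_trans /(_ lw).
  by rewrite -EFinB lee_fin r2 leNgt Er.
(* Monotonicity of the outer measure carries the bound from the measurable set [bad] to the sublevel
   event. *)
apply: le_trans (le_mu_ext _ sub) _.
rewrite measurable_mu_extE//; apply: le_trans Pbad _; rewrite lee_fin.
apply: ler_pM => //.
- by rewrite exprn_ge0// ltW.
- rewrite -(ler_pM2r X0) /X -powD subrK powRr1 ?(ltW N0)//.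
  apply: (@le_trans _ _ ((N %/ n)%:R * n%:R)).
    by rewrite ler_wpM2l// (ltW nX).
  by rewrite -natrM ler_nat leq_divM.
- have -> : q ^+ n = expR (n%:R * ln q) by rewrite expRM_natl lnK// posrE.
  rewrite ler_expR -/X opprK mulrC.
  by rewrite ler_nM2l ?(ltW nX)// -oppr_gt0.
Qed.
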